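(* Let $\mathbf q=(q_1,\dots,q_k)$ be a $k$-tuple of positive regular noncommutative polynomials and let $\mathbf S=\{\mathbf S_{i,j}\}$ be the universal model associated with the abstract noncommutative variety $\mathcal V^{\mathbf m}_{\mathbf q,J}$, where $J$ is a WOT-closed left ideal of $F^\infty(\mathbf D^{\mathbf m}_{\mathbf q})$ such that $1\in\mathcal N_J$, and suppose that $$\overline{\mathrm{span}}\{\mathbf S_{(\alpha)}\mathbf S_{(\beta)}^*:\ (\alpha),(\beta)\in\mathbb F^+_{n_1}\times\cdots\times\mathbb F^+_{n_k}\}=C^*(\mathbf S_{i,j}).$$ Then the following statements hold. (i) If $\mathcal M\subset\mathcal N_J$ is a co-invariant subspace under each operator $\mathbf S_{i,j}$, then $\mathbf T:=\{P_{\mathcal M}\mathbf S_{i,j}|_{\mathcal M}\}$ is a pure element in the noncommutative variety $\mathcal V^{\mathbf m}_{\mathbf q,J}(\mathcal M)$ and $\operatorname{rank}\Delta^{\mathbf m}_{\mathbf q,\mathbf T}(I)=1$. (ii) If $\mathcal M'$ is another co-invariant subspace under each operator $\mathbf S_{i,j}$, which gives rise to $\mathbf T':=\{P_{\mathcal M'}\mathbf S_{i,j}|_{\mathcal M'}\}$, then $\mathbf T$ and $\mathbf T'$ are unitarily equivalent if and only if $\mathcal M=\mathcal M'$.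
   Context: Fix $k\ge 1$ and $(n_1,\dots,n_k)$, $\mathbf m=(m_1,\dots,m_k)$ in $\mathbb N^k$, $\mathbb N=\{1,2,\dots\}$. Hilbert spaces are complex and separable. $\mathbb F^+_{n_i}$ is the free unital semigroup on generators $g^i_1,\dots,g^i_{n_i}$ with identity $g^i_0$; $|\alpha|$ is word length. For $X_i=(X_{i,1},\dots,X_{i,n_i})$ and $\alpha=g^i_{j_1}\cdots g^i_{j_p}$ put $X_{i,\alpha}=X_{i,j_1}\cdots X_{i,j_p}$, $X_{i,g^i_0}=I$; for $\mathbf X=(X_1,\dots,X_k)$ and $(\alpha)=(\alpha_1,\dots,\alpha_k)$ put $\mathbf X_{(\alpha)}=X_{1,\alpha_1}\cdots X_{k,\alpha_k}$. A polynomial $q_i=\sum_{\alpha\in\mathbb F_{n_i}^+}a_{i,\alpha}Z_{i,\alpha}$ in noncommuting indeterminates is positive regular if $a_{i,\alpha}\ge0$, $a_{i,g^i_0}=0$, $a_{i,g^i_j}>0$ for $1\le j\le n_i$. Put $\Phi_{q_i,X_i}(Y)=\sum_{\alpha}a_{i,\alpha}X_{i,\alpha}YX_{i,\alpha}^*$ and $\Delta^{\mathbf p}_{\mathbf q,\mathbf X}=(id-\Phi_{q_1,X_1})^{p_1}\circ\cdots\circ(id-\Phi_{q_k,X_k})^{p_k}$, $\mathbf p\in\mathbb Z_+^k$. $\mathbf D^{\mathbf m}_{\mathbf q}(\mathcal H)$ is the set of all $\mathbf X\in B(\mathcal H)^{n_1}\times\cdots\times B(\mathcal H)^{n_k}$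 such that the entries of $X_s$ commute with those of $X_t$ for $s\ne t$ and $\Delta^{\mathbf p}_{\mathbf q,\mathbf X}(I)\ge0$ for all $\mathbf 0\le\mathbf p\le\mathbf m$ (componentwise). $\mathbf X$ is pure if $\lim_{(s_1,\dots,s_k)\in\mathbb Z_+^k}(id-\Phi_{q_k,X_k}^{s_k})\cdots(id-\Phi_{q_1,X_1}^{s_1})(I)=I$ (weak operator topology). $F^2(H_{n_i})=\mathbb C1\oplus\bigoplus_{p\ge1}H_{n_i}^{\otimes p}$ is the full Fock space over an $n_i$-dimensional Hilbert space, with orthonormal basis $\{e^i_\alpha\}_{\alpha\in\mathbb F^+_{n_i}}$, $e^i_{g^i_0}=1$. Set $b^{(m_i)}_{i,g^i_0}=1$ and $b^{(m_i)}_{i,\alpha}=\sum_{p=1}^{|\alpha|}\sum_{\gamma_1\cdots\gamma_p=\alpha,\,|\gamma_s|\ge1}a_{i,\gamma_1}\cdots a_{i,\gamma_p}\binom{p+m_i-1}{m_i-1}$ for $|\alpha|\ge1$; $W_{i,j}e^i_\alpha=\sqrt{b^{(m_i)}_{i,\alpha}/b^{(m_i)}_{i,g^i_j\alpha}}\;e^i_{g^i_j\alpha}$; $\mathbf W_{i,j}=I\otimes\cdots\otimes W_{i,j}\otimes\cdots\otimes I$ ($i$-th factor) on $\otimes_{i=1}^kF^2(H_{n_i})$. $F^\infty(\mathbf D^{\mathbf m}_{\mathbf q})$ is the sequential SOT- (equivalently WOT-, $w^*$-) closure of the polynomials in the $\mathbf W_{i,j}$ and $I$; each $g$ in it has a unique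 Fourier representation $g=\sum_{(\beta)}c_{(\beta)}\mathbf W_{(\beta)}$, and for pure $\mathbf X$, $g(\mathbf X)=\text{SOT-}\lim_{r\to1}\sum_{s\ge0}\sum_{|\beta_1|+\cdots+|\beta_k|=s}r^sc_{(\beta)}\mathbf X_{(\beta)}$. $\mathcal M_J$ is the closure of $J(\otimes_iF^2(H_{n_i}))$, $\mathcal N_J=[\otimes_iF^2(H_{n_i})]\ominus\mathcal M_J$; $\mathbf S_{i,j}=P_{\mathcal N_J}\mathbf W_{i,j}|_{\mathcal N_J}$; $1$ is the vacuum vector; $C^*(\mathbf S_{i,j})$ is the $C^*$-algebra generated by all $\mathbf S_{i,j}$ and $I$. A pure element of $\mathcal V^{\mathbf m}_{\mathbf q,J}(\mathcal H)$ is a pure $\mathbf T\in\mathbf D^{\mathbf m}_{\mathbf q}(\mathcal H)$ with $g(\mathbf T)=0$ for all $g\in J$. A subspace is co-invariant under $X$ if it is invariant under $X^*$. Tuples $\{T_{i,j}\}$ on $\mathcal H$ and $\{T'_{i,j}\}$ on $\mathcal H'$ are unitarily equivalent if there is a unitary $U:\mathcal H\to\mathcal H'$ with $T_{i,j}=U^*T'_{i,j}U$ for all $i,j$. *)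

(* Defs.v *)
From HB Require Import structures.
From mathcomp Require Import all_boot all_order all_algebra.
From mathcomp Require Import finmap.
From mathcomp Require Import complex.
From mathcomp Require Import all_classical all_reals all_analysis.

Set Implicit Arguments.
Unset Strict Implicit.
Unset Printing Implicit Defensive.

Import Order.TTheory GRing.Theory Num.Theory.
Import numFieldNormedType.Exports.

Local Open Scope classical_set_scope.
Local Open Scope complex_scope.
Local Open Scope ring_scope.

(* Complex Hilbert spaces: complete normed spaces over R[i] whose norm comes from
   an inner product, linear in the first argument. *)
Record hilbertType (R : realType) := Hilbert {
  hilbert_sort :> completeNormedModType R[i];
  hdot : {dot hilbert_sort for (@Num.conj R[i])};
  hdotE : forall x, hdot x x = `|x| ^+ 2 }.

Arguments hdot {R h}.
Arguments hdotE {R h}.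


Section HilbertFacts.
Context (R : realType) (H : hilbertType R).
Implicit Types x y z : H.

Lemma hdotDl x y z : hdot (x + y) z = hdot x z + hdot y z.
Proof. exact: linearDl. Qed.

Lemma hdotZl a x y : hdot (a *: x) y = a * hdot x y.
Proof. exact: linearZl_LR. Qed.

Lemma hdotBl x y z : hdot (x - y) z = hdot x z - hdot y z.
Proof. by rewrite -scaleN1r hdotDl hdotZl mulN1r. Qed.

Lemma hdotC x y : hdot x y = Num.conj (hdot y x).
Proof. by rewrite hermC expr0 mul1r. Qed.

Lemma hdotBr x y z : hdot x (y - z) = hdot x y - hdot x z.
Proof. by rewrite hdotC hdotBl rmorphB /= -!hdotC. Qed.

Lemma hdotZr a x y : hdot x (a *: y) = Num.conj a * hdot x y.
Proof. by rewrite hdotC hdotZl rmorphM /= -hdotC. Qed.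

Lemma hdot0l y : hdot 0 y = 0.
Proof. by rewrite -(scale0r (0 : H)) hdotZl mul0r. Qed.

Lemma hdot_CauchySchwarz x y : `|hdot x y| <= `|x| * `|y|.
Proof.
have [->|y0] := eqVneq y 0.
  by rewrite -(scale0r (0 : H)) hdotZr rmorph0 mul0r normr0 scale0r normr0 mulr0.
have ny0 : 0 < `|y| by rewrite normr_gt0.
have yy0 : `|y| ^+ 2 != 0 by rewrite expf_neq0// gt_eqF.
pose a := hdot x y / `|y| ^+ 2.
have : 0 <= hdot (x - a *: y) (x - a *: y) by rewrite hdotE exprn_ge0.
rewrite hdotBl !hdotBr !hdotZl !hdotZr !hdotE.
have -> : a * (Num.conj a * `|y| ^+ 2) = a * hdot y x.
  rewrite (hdotC y x) /a rmorphM /= fmorphV /=.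
  rewrite (_ : Num.conj (`|y| ^+ 2) = `|y| ^+ 2) ?divfK//.
  by rewrite -hdotE -hdotC.
rewrite subrr subr0 subr_ge0.
have -> : Num.conj a * hdot x y = `|hdot x y| ^+ 2 / `|y| ^+ 2.
  rewrite normCKC /a rmorphM /= fmorphV /= mulrAC.
  by congr (_ / _); rewrite -hdotE -hdotC.
rewrite ler_pdivrMr ?exprn_gt0// -exprMn.
by rewrite ler_pXn2r// ?nnegrE ?mulr_ge0.
Qed.

End HilbertFacts.

Record closed_subspace (R : realType) (H : hilbertType R) := ClosedSubspace {
  csub_set : set H;
  csub_submod : submod_closed [pred x | x \in csub_set];
  csub_closed : closed csub_set }.

(* A closed subspace is itself a Hilbert space, carried by a subtype of H with
   the restricted norm and inner product. *)
Section Subspace.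
Context (R : realType) (H : hilbertType R) (M : closed_subspace H).

Definition csub_pred : {pred H} := [pred x | x \in csub_set M].

HB.instance Definition _ := GRing.isSubmodClosed.Build R[i] H csub_pred
  (csub_submod M).

Definition csub_type := {x : H | x \in csub_pred}.

HB.instance Definition _ := SubType.on csub_type.
HB.instance Definition _ := [Choice of csub_type by <:].
HB.instance Definition _ := [SubChoice_isSubLmodule of csub_type by <:].

Definition csub_norm (x : csub_type) : R[i] := `|val x|.

Lemma csub_normD x y : csub_norm (x + y) <= csub_norm x + csub_norm y.
Proof. by rewrite /csub_norm raddfD ler_normD. Qed.

Lemma csub_normZ (l : R[i]) x : csub_norm (l *: x) = `|l| * csub_norm x.
Proof. by rewrite /csub_norm linearZ normrZ. Qed.

Lemma csub_norm0_eq0 x : csub_norm x = 0 -> x = 0.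
Proof. by move=> /normr0_eq0 x0; apply/val_inj; rewrite x0 raddf0. Qed.

HB.instance Definition _ := Lmodule_isNormed.Build R[i] csub_type
  csub_normD csub_normZ csub_norm0_eq0.

Lemma csub_complete (F : set_system csub_type) :
  ProperFilter F -> cauchy F -> cvg F.
Proof.
move=> FF /cauchyP Fc.
have Gc : cauchy ((val : csub_type -> H) @ F).
  apply/cauchyP => e e0.
  have [x Fx] := Fc e e0.
  exists (val x); apply: (@filterS _ F _ (ball x e)) Fx => y.
  by rewrite /= -!ball_normE /ball_ /= {1}/Num.norm /= /csub_norm raddfB.
have /cauchy_cvg/cvg_ex[l Gl] := Gc.
have Ml : l \in csub_pred.
  rewrite /csub_pred !inE.
  apply: (closed_cvg (csub_set M) (@csub_closed _ _ M) _ l Gl).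
  by apply: nearW => y; have := valP y; rewrite /csub_pred !inE.
apply/cvg_ex; exists (Sub l Ml : csub_type); apply/cvgrPdist_lt => e e0.
move/cvgrPdist_lt : Gl => /(_ e e0); apply: filterS => y.
by rewrite {2}/Num.norm /= /csub_norm raddfB.
Qed.

HB.instance Definition _ := Uniform_isComplete.Build csub_type csub_complete.

Definition csub_dot (x y : csub_type) : R[i] := hdot (val x) (val y).

Lemma csub_dot_bilinear :
  bilinear_for *%R (Num.conj \; *%R) csub_dot.
Proof.
have vP a (u v : csub_type) : val (a *: u + v) = a *: val u + val v :> H.
  exact: linearP.
split=> [y a u v|x a u v]; rewrite /csub_dot vP.
  by rewrite hdotDl hdotZl.
by rewrite hdotC hdotDl hdotZl rmorphD rmorphM /= -!hdotC.
Qed.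

HB.instance Definition _ := bilinear_isBilinear.Build R[i] csub_type csub_type
  R[i] *%R (Num.conj \; *%R) csub_dot csub_dot_bilinear.

Lemma csub_dot_hermitian (x y : csub_type) :
  csub_dot x y = (-1) ^+ false * Num.conj (csub_dot y x).
Proof. by rewrite expr0 mul1r /csub_dot hdotC. Qed.

HB.instance Definition _ := isHermitianSesquilinear.Build R[i] csub_type
  false (@Num.conj R[i]) csub_dot csub_dot_hermitian.

Lemma csub_dotE (x : csub_type) : csub_dot x x = `|x| ^+ 2.
Proof. exact: hdotE. Qed.

Lemma csub_dot_gt0 (x : csub_type) : x != 0 -> 0 < csub_dot x x.
Proof. by move=> x0; rewrite csub_dotE exprn_gt0// normr_gt0. Qed.

HB.instance Definition _ := isDotProduct.Build R[i] csub_type csub_dot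
  csub_dot_gt0.

Definition csub_hilbert : hilbertType R :=
  @Hilbert R csub_type csub_dot csub_dotE.

End Subspace.
Coercion csub_hilbert : closed_subspace >-> hilbertType.

Section Orthocomplement.
Context (R : realType) (H : hilbertType R) (G : set H).

Definition ortho_set : set H := [set y | forall x, G x -> hdot y x = 0].

Lemma ortho_submod : submod_closed [pred x | x \in ortho_set].
Proof.
split=> [|a u v]; rewrite !inE /=; first by move=> x _; exact: hdot0l.
by move=> Gu Gv x Gx; rewrite hdotDl hdotZl Gu ?Gv// mulr0 addr0.
Qed.

Lemma ortho_closed : closed ortho_set.
Proof.
move=> y cy x Gx; apply/eqP; rewrite -normr_eq0.
case: eqVneq => // yx0; have x1 : 0 < `|x| + 1 by rewrite ltr_wpDl.
have e0 : 0 < `|hdot y x| by rewrite lt_neqAle eq_sym yx0 normr_ge0.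
have d0 : 0 < `|hdot y x| / (`|x| + 1) by rewrite divr_gt0.
have [z [Gz]] := cy _ (nbhsx_ballx y _ d0).
rewrite -ball_normE /= => yz.
have : `|hdot y x| < `|hdot y x|; last by rewrite ltxx.
have {1}-> : hdot y x = hdot (y - z) x by rewrite hdotBl (Gz x Gx) subr0.
apply: le_lt_trans (hdot_CauchySchwarz _ _) _.
rewrite -[ltRHS](divfK (lt0r_neq0 x1)).
apply: (@le_lt_trans _ _ (`|hdot y x| / (`|x| + 1) * `|x|)).
  by rewrite ler_wpM2r// ltW.
by rewrite ltr_pM2l// ltrDl.
Qed.

Definition orthocomplement := ClosedSubspace ortho_submod ortho_closed.

End Orthocomplement.

Section Operators.
Context (R : realType).
Implicit Types H K : hilbertType R.

Definition bounded_op H K (A : H -> K) : Prop :=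
  linear A /\ exists c : R[i], forall x, `|A x| <= c * `|x|.

(* The Hilbert space adjoint; for a bounded A the set below is a singleton. *)
Definition adj H K (A : H -> K) : K -> H :=
  xget (cst 0) [set B | forall x y, hdot (A x) y = hdot x (B y)].

Definition positive_op H (A : H -> H) : Prop := forall x, 0 <= hdot (A x) x.

Definition unitary_op H K (U : H -> K) : Prop :=
  [/\ linear U, forall x y, hdot (U x) (U y) = hdot x y & range U = setT].

(* rank A = r : the range of A has a basis of r vectors. *)
Definition has_rank H (A : H -> H) (r : nat) : Prop :=
  exists v : 'I_r -> H,
    (forall c : 'I_r -> R[i], \sum_l c l *: v l = 0 -> forall l, c l = 0) /\
    range A = [set \sum_l c l *: v l | c in [set: 'I_r -> R[i]]].

Definition lspan (V : lmodType R[i]) (G : set V) : set V :=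
  [set x | exists (r : nat) (c : 'I_r -> R[i]) (v : 'I_r -> V),
    (forall l, G (v l)) /\ x = \sum_l c l *: v l].

Definition orthonormal_basis H (T : eqType) (e : T -> H) : Prop :=
  (forall a b, hdot (e a) (e b) = (a == b)%:R) /\
  closure (lspan (range e)) = setT.

Definition csub_val H (M : closed_subspace H) (x : M) : H :=
  val (x : csub_type M).

(* Orthogonal projection of H onto M, as a map into the Hilbert space M. *)
Definition proj H (M : closed_subspace H) (x : H) : M :=
  xget (0 : M) [set p : M | forall y : M, hdot (x - csub_val p) (csub_val y) = 0].

Definition compress H (M : closed_subspace H) (A : H -> H) : M -> M :=
  fun x => proj M (A (csub_val x)).
Arguments compress {H} M A x.

Definition opnorm_closure H (B : set (H -> H)) : set (H -> H) :=
  [set A | bounded_op A /\ forall eps : R, 0 < eps ->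
    exists2 A', B A' & forall x, `|A x - A' x| <= eps%:C * `|x|].

Definition wot_closed H (B : set (H -> H)) : Prop :=
  forall A, bounded_op A ->
    (forall (r : nat) (x y : 'I_r -> H) (eps : R), 0 < eps ->
      exists2 A', B A' & forall l, `|hdot (A (x l) - A' (x l)) (y l)| < eps%:C) ->
    B A.

Definition unital_subalgebra H (B : set (H -> H)) : Prop :=
  [/\ B idfun,
      forall (a : R[i]) A A', B A -> B A' -> B (a *: A + A') &
      forall A A', B A -> B A' -> B (A \o A')].

Definition cstar_subalgebra H (B : set (H -> H)) : Prop :=
  [/\ B `<=` @bounded_op H H, unital_subalgebra B,
      forall A, B A -> B (adj A) & opnorm_closure B `<=` B].

Definition cstar_generated H (G : set (H -> H)) : set (H -> H) :=
  smallest (@cstar_subalgebra H) G.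

End Operators.

Arguments compress {R H} M A x.

Section Tuples.
Context (R : realType) (k : nat) (n : 'I_k -> nat).
Implicit Types H : hilbertType R.

Definition optuple (H : Type) := forall i : 'I_k, 'I_(n i) -> H -> H.

(* Elements of the product of the free semigroups; the empty word is the
   identity and concatenation the product of each factor. *)
Definition mword := {dffun forall i : 'I_k, seq 'I_(n i)}.

Definition mlength (b : mword) : nat := (\sum_i size (b i))%N.

Definition opcomps (T : Type) (s : seq (T -> T)) : T -> T :=
  foldr (fun A B => A \o B) idfun s.

Definition wordop (T : Type) (l : nat) (X : 'I_l -> T -> T) (a : seq 'I_l) :=
  opcomps [seq X j | j <- a].

Definition mwordop (T : Type) (X : optuple T) (b : mword) : T -> T :=
  opcomps [seq wordop (X i) (b i) | i <- enum 'I_k].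

(* A noncommutative polynomial is given by its coefficients. *)
Definition ncpoly (l : nat) := {fsfun seq 'I_l -> R with 0}.

Definition positive_regular (l : nat) (q : ncpoly l) : Prop :=
  [/\ forall a, 0 <= q a, q [::] = 0 & forall j, 0 < q [:: j]].

(* Phi_{q,X}(Y) = \sum_a q_a X_a Y X_a^* *)
Definition Phi H (l : nat) (q : ncpoly l) (X : 'I_l -> H -> H) (Y : H -> H) :
    H -> H :=
  \sum_(a <- finsupp q) (q a)%:C *: (wordop X a \o Y \o adj (wordop X a)).

Context (q : forall i, ncpoly (n i)).

(* (id - Phi_1)^{p_1} o ... o (id - Phi_k)^{p_k} applied to Y *)
Definition defect H (X : optuple H) (p : 'I_k -> nat) (Y : H -> H) : H -> H :=
  foldr (fun i Z => iter (p i) (fun Z' => Z' - Phi (q i) (X i) Z') Z) Y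
    (enum 'I_k).

Definition polydomain (m : 'I_k -> nat) H (X : optuple H) : Prop :=
  [/\ forall i j, bounded_op (X i j),
      forall s t, s != t -> forall i j, X s i \o X t j = X t j \o X s i &
      forall p : 'I_k -> nat, (forall i, p i <= m i)%N ->
        positive_op (defect X p idfun)].

(* (id - Phi_k^{s_k}) ... (id - Phi_1^{s_1}) (I) *)
Definition pure_net H (X : optuple H) (s : 'I_k -> nat) : H -> H :=
  foldl (fun Z i => Z - iter (s i) (Phi (q i) (X i)) Z) idfun (enum 'I_k).

(* The filter of the directed set N^k with its componentwise order. *)
Definition product_net : set_system ('I_k -> nat) :=
  filter_from setT (fun s0 => [set s | forall i, s0 i <= s i]%N).

Definition pure H (X : optuple H) : Prop :=
  forall x y, (hdot (pure_net X s x) y : R[i]^o) @[s --> product_net]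
    --> (hdot x y : R[i]^o).

Definition unitarily_equivalent H H' (T : optuple H) (T' : optuple H') : Prop :=
  exists2 U : H -> H', unitary_op U &
    forall i j, T i j = adj U \o T' i j \o U.

Definition coinvariant H (X : optuple H) (M : set H) : Prop :=
  forall i j x, M x -> M (adj (X i j) x).

End Tuples.

Section FockSpaces.
Context (R : realType).

(* The full Fock space of an l-dimensional Hilbert space, with its orthonormal
   basis indexed by words. *)
Record fock_space (l : nat) := Fock {
  fock_hilbert :> hilbertType R;
  fock_basis : seq 'I_l -> fock_hilbert;
  fock_basisP : orthonormal_basis fock_basis }.

(* The Hilbert space tensor product of a finite family: tens is multilinear,
   inner products of elementary tensors factor, and elementary tensors span a
   dense subspace. *)
Record hilbert_tensor (k : nat) (F : 'I_k -> hilbertType R) := HilbertTensor {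
  tensor_hilbert :> hilbertType R;
  tens : (forall i, F i) -> tensor_hilbert;
  tens_multilinear : forall (x : forall i, F i) (i : 'I_k),
    linear (fun y : F i => tens (dfwith x i y));
  hdot_tens : forall x y, hdot (tens x) (tens y) = \prod_i hdot (x i) (y i);
  tens_total : closure (lspan (range tens)) = setT }.

(* The inner sum runs over the factorizations a = g_1 ... g_p into nonempty
   words; each g_s has length at most |a|, so they live in a finite type. *)
Definition bcoef (l : nat) (q : ncpoly R l) (m : nat) (a : seq 'I_l) : R :=
  if a is [::] then 1 else
  \sum_(1 <= p < (size a).+1)
    \sum_(g : p.-tuple {bseq size a of 'I_l} |
          (flatten [seq val w | w <- g] == a) &&
          all (fun w => 0 < size (val w))%N g)
      (\prod_(w <- g) q (val w)) * 'C(p + m - 1, m - 1)%:R.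

(* The set below is a singleton, as a bounded operator is determined by its
   values on an orthonormal basis. *)
Definition weighted_shift (l : nat) (q : ncpoly R l) (m : nat)
    (F : fock_space l) (j : 'I_l) : F -> F :=
  xget (cst 0) [set A | bounded_op A /\ forall a,
    A (fock_basis F a) =
      (Num.sqrt (bcoef q m a / bcoef q m (j :: a)))%:C
        *: fock_basis F (j :: a)].

Context (k : nat) (n m : 'I_k -> nat) (q : forall i, ncpoly R (n i)).
Context (F : forall i, fock_space (n i)) (E : hilbert_tensor F).

(* I (x) ... (x) W_{i,j} (x) ... (x) I, determined by its values on elementary
   tensors. *)
Definition tensor_shift : optuple n E := fun i j =>
  xget (cst 0) [set A | bounded_op A /\ forall x : forall i, F i,
    A (tens E x) = tens E (dfwith x i (weighted_shift (q i) (m i) j (x i)))].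
Arguments tensor_shift i j : clear implicits.

Definition tensor_basis (b : mword n) : E :=
  tens E (fun i => fock_basis (F i) (b i)).

Definition vacuum : E := tens E (fun i => fock_basis (F i) [::]).

Definition op_polynomials : set (E -> E) :=
  smallest (@unital_subalgebra R E)
    [set A | exists i j, A = tensor_shift i j].

(* F^oo : limits, in the strong operator topology, of sequences of
   polynomials in the shifts. *)
Definition hardy_algebra : set (E -> E) :=
  [set g | bounded_op g /\ exists2 p : nat -> E -> E,
    forall l, op_polynomials (p l) & forall x, p l x @[l --> \oo] --> g x].

Definition fset_net : set_system {fset mword n} :=
  filter_from setT (fun A => [set B | (A `<=` B)%fset]).

(* g = \sum_b c_b W_b, the series being summed unconditionally on each vector
   of the orthonormal basis. *)
Definition fourier_rep (g : E -> E) (c : mword n -> R[i]) : Prop :=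
  forall a : mword n,
    \sum_(b <- B) c b *: mwordop tensor_shift b (tensor_basis a)
      @[B --> fset_net] --> g (tensor_basis a).

(* A = SOT-lim_(r -> 1) \sum_s \sum_(|b| = s) r^s c_b X_b, where for r < 1 the
   series over s converges in operator norm; the multi-words of length s form a
   finite set. *)
Definition functional_calculus (c : mword n -> R[i]) (H : hilbertType R)
    (X : optuple n H) (A : H -> H) : Prop :=
  exists2 G : R -> H -> H,
    forall r : R, 0 <= r < 1 -> forall eps : R, 0 < eps ->
      \forall N \near \oo, forall x,
        `|\sum_(0 <= s < N) \sum_(b \in [set b : mword n | mlength b = s])
            ((r ^+ s)%:C * c b) *: mwordop X b x - G r x| <= eps%:C * `|x| &
    forall x, G r x @[r --> (1 : R)^'-] --> A x.

Definition wot_closed_left_ideal (J : set (E -> E)) : Prop :=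
  [/\ J `<=` hardy_algebra,
      J (cst 0),
      forall (a : R[i]) A A', J A -> J A' -> J (a *: A + A'),
      forall f g, hardy_algebra f -> J g -> J (f \o g) &
      wot_closed J].

Definition ideal_range (J : set (E -> E)) : set E :=
  closure (lspan [set y | exists g x, J g /\ y = g x]).

Definition ideal_coker (J : set (E -> E)) : closed_subspace E :=
  orthocomplement (ideal_range J).

Definition universal_model (J : set (E -> E)) : optuple n (ideal_coker J) :=
  fun i j => compress (ideal_coker J) (tensor_shift i j).

(* T is a pure element of the variety of J: g(T) = 0 for every g in J. *)
Definition pure_variety (J : set (E -> E)) (H : hilbertType R)
    (T : optuple n H) : Prop :=
  [/\ polydomain q m T, pure q T &
      forall g, J g -> exists2 c, fourier_rep g c &
        functional_calculus c T (cst 0)].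

End FockSpaces.

Arguments tensor_shift {R k n} m q {F E} i j.
Arguments universal_model {R k n} m q {F E} J i j.

(* Main.v *)
Require Import Defs.
From mathcomp Require Import all_boot all_order all_algebra.
From mathcomp Require Import finmap complex.
From mathcomp Require Import ring lra.
From mathcomp Require Import all_classical all_reals all_analysis.

Set Implicit Arguments.
Unset Strict Implicit.
Unset Printing Implicit Defensive.

Import Order.TTheory GRing.Theory Num.Theory.
Import numFieldNormedType.Exports.

Local Open Scope classical_set_scope.
Local Open Scope complex_scope.
Local Open Scope ring_scope.

(** A co-invariant subspace of the model space is a co-invariant subspace of the
    whole tensor product of Fock spaces, because the range of a left ideal is
    invariant under the shifts [W]. Hence everything is about an isometry [V] and
    a tuple [T] with [W_j^* V = V T_j^*] ([coextension]); the inclusions and the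
    unitary equivalences are all of this form, and [Phi], the defects and the
    words in [T] are then the compressions [V^* _ V] of those in [W].

    For the shifts, all operators obtained from the identity by the maps [Phi]
    are diagonal. With a diagonal operator described by its eigenvalues times the
    weights, [Phi] in the slot [i] is convolution with the coefficients of [q i],
    and the weights are the coefficients of [1 / (1 - q i)^(m i)]. So the defect of
    order [p] corresponds to the product of the series [1 / (1 - q i)^(m i - p i)],
    which has nonnegative coefficients, and the defect of order [m] is the
    projection on the vacuum ([defect_shift]). Purity holds because high powers of
    [q i] have no coefficient at a given word. Compressing, the defect of [T] is
    [x |-> <x, u> u] with [u = V^* 1], and [u] is nonzero because a vector
    orthogonal to all [W_b 1] vanishes.

    That [g] in the ideal annihilates [T] comes down to the strong convergence of
    the Abel means of the Fourier series of [g] to [g] itself ([abel_means]), as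
    the compression of [g] is zero. Limits of polynomials in the shifts have a
    Toeplitz matrix ([toeplitz_hardy]), whose entries are the Fourier
    coefficients. The Abel mean multiplies the matrix entry at words of lengths
    [p] and [p'] by [r ^ |p - p'|], a positive definite kernel with ones on the
    diagonal; such a Schur multiplier does not increase norms, and the convergence
    is clear on the basis. The same argument bounds the homogeneous parts.

    Finally let [U] be a unitary equivalence from [T] to [T']. The defects of [T]
    and [T'] correspond under [U], so that
    [<V x, W_b 1> <W_a 1, V x> = <V' U x, W_b 1> <W_a 1, V' U x>]
    for all words [a] and [b]. A rank-one matrix determines its vector up to a
    scalar and the vectors [W_b 1] are total, so [V x] and [V' U x] are multiples
    of each other, and the two subspaces coincide ([coext_equivalence]). *)

(** * Hilbert spaces *)

Section InnerProduct.
Context (R : realType) (H : hilbertType R).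
Implicit Types x y z : H.

Lemma hdotDr x y z : hdot x (y + z) = hdot x y + hdot x z.
Proof. by rewrite hdotC hdotDl rmorphD /= -!hdotC. Qed.

Lemma hdot0r x : hdot x 0 = 0.
Proof. by rewrite hdotC hdot0l rmorph0. Qed.

Lemma hdot_suml (I : Type) (r : seq I) (P : pred I) (f : I -> H) y :
  hdot (\sum_(i <- r | P i) f i) y = \sum_(i <- r | P i) hdot (f i) y.
Proof.
by apply: (big_morph (hdot^~ y)) => [u v|]; rewrite ?hdotDl ?hdot0l.
Qed.

Lemma hdot_sumr (I : Type) (r : seq I) (P : pred I) (f : I -> H) x :
  hdot x (\sum_(i <- r | P i) f i) = \sum_(i <- r | P i) hdot x (f i).
Proof. by apply: (big_morph (hdot x)) => [u v|]; rewrite ?hdotDr ?hdot0r. Qed.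

Lemma hdot_eq0 x : hdot x x = 0 -> x = 0.
Proof. by rewrite hdotE => /eqP; rewrite expf_eq0 /= normr_eq0 => /eqP. Qed.

Lemma hdot_inj x y : (forall z, hdot x z = hdot y z) -> x = y.
Proof.
move=> xy; apply/subr0_eq/hdot_eq0.
by rewrite hdotBl xy subrr.
Qed.

Lemma hdot_injr x y : (forall z, hdot z x = hdot z y) -> x = y.
Proof. by move=> xy; apply: hdot_inj => z; rewrite hdotC xy -hdotC. Qed.

End InnerProduct.

Section RealNorm.
Context (R : realType).

Lemma realCM (x y : R) : (x * y)%:C = x%:C * y%:C :> R[i].
Proof. exact: rmorphM. Qed.

Lemma realCV (x : R) : (x^-1)%:C = (x%:C)^-1 :> R[i].
Proof. exact: fmorphV. Qed.

Lemma realC_sum (I : Type) (r : seq I) (P : pred I) (f : I -> R) :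
  (\sum_(i <- r | P i) f i)%:C = \sum_(i <- r | P i) (f i)%:C :> R[i].
Proof. exact: rmorph_sum. Qed.

(** Norms take values in the partially ordered field [R[i]], but they are real;
    estimates are easier in the totally ordered field of their real parts. *)
Definition nrm (V : normedModType R[i]) (x : V) : R := complex.Re `|x|.

Section Generic.
Context (V : normedModType R[i]).
Implicit Types x y : V.

Lemma nrmE x : `|x| = (nrm x)%:C.
Proof. by rewrite /nrm RRe_real// ger0_real. Qed.

Lemma nrm_ge0 x : 0 <= nrm x.
Proof. by have := normr_ge0 x; rewrite nrmE lecR. Qed.

Lemma nrm0 : nrm (0 : V) = 0.
Proof. by rewrite /nrm normr0. Qed.

Lemma nrmN x : nrm (- x) = nrm x.
Proof. by rewrite /nrm normrN. Qed.

Lemma nrmB x y : nrm (x - y) = nrm (y - x).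
Proof. by rewrite /nrm distrC. Qed.

Lemma nrmD x y : nrm (x + y) <= nrm x + nrm y.
Proof. by rewrite -lecR rmorphD /= -!nrmE ler_normD. Qed.

Lemma nrm0_eq0 x : nrm x = 0 -> x = 0.
Proof. by move=> x0; apply/normr0_eq0; rewrite nrmE x0. Qed.

Lemma nrm_sum (I : Type) (r : seq I) (P : pred I) (f : I -> V) :
  nrm (\sum_(i <- r | P i) f i) <= \sum_(i <- r | P i) nrm (f i).
Proof.
elim/big_rec2: _ => [|i y x Pi xy]; first by rewrite nrm0.
by apply: le_trans (nrmD _ _) _; rewrite lerD2l.
Qed.

Lemma nrm_cvgP (T : Type) (F : set_system T) (FF : Filter F) (f : T -> V) x :
  f @ F --> x <-> forall e : R, 0 < e -> \forall t \near F, nrm (x - f t) < e.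
Proof.
split=> [/cvgrPdist_lt fx e e0|fx].
  have /fx : 0 < e%:C by rewrite ltcR.
  by apply: filterS => t; rewrite nrmE ltcR.
apply/cvgrPdist_lt => e e0.
have eE : e = (complex.Re e)%:C by rewrite RRe_real// gtr0_real.
have : 0 < complex.Re e by rewrite -ltcR -eE.
by move=> /fx; apply: filterS => t; rewrite nrmE eE ltcR.
Qed.

End Generic.

Definition cabs (z : R[i]) : R := nrm (z : R[i]^o).

Lemma cabsE (z : R[i]) : `|z| = (cabs z)%:C.
Proof. exact: (@nrmE R[i]^o). Qed.

Lemma cabs_ge0 z : 0 <= cabs z. Proof. exact: nrm_ge0. Qed.

Lemma cabsM x y : cabs (x * y) = cabs x * cabs y.
Proof. by apply/(@complexI R); rewrite rmorphM /= -!cabsE normrM. Qed.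

Lemma cabsR (x : R) : cabs x%:C = `|x|.
Proof. by apply/(@complexI R); rewrite -cabsE normc_def /= expr0n addr0 sqrtr_sqr. Qed.

Lemma nrmZ (V : normedModType R[i]) a (x : V) : nrm (a *: x) = cabs a * nrm x.
Proof. by apply/(@complexI R); rewrite rmorphM /= -cabsE -!nrmE normrZ. Qed.

End RealNorm.

Section HilbertNorm.
Context (R : realType) (H : hilbertType R).
Implicit Types x y z w : H.

Lemma hdot_nrm x : hdot x x = (nrm x ^+ 2)%:C.
Proof. by rewrite hdotE nrmE rmorphXn. Qed.

Lemma cabs_hdot x y : cabs (hdot x y) <= nrm x * nrm y.
Proof. by have := hdot_CauchySchwarz x y; rewrite cabsE !nrmE -rmorphM lecR. Qed.

Lemma conjR (t : R) : Num.conj t%:C = t%:C :> R[i].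
Proof. by rewrite -[LHS]/(conjc t%:C) conjc_real. Qed.

Lemma conjMR a (t : R) : Num.conj (a * t%:C) = Num.conj a * t%:C :> R[i].
Proof.
have -> : Num.conj (a * t%:C) = Num.conj a * Num.conj (t%:C : R[i]).
  exact: rmorphM.
by rewrite conjR.
Qed.

Lemma mul_conj_cabs (a : R[i]) : a * Num.conj a = (cabs a ^+ 2)%:C.
Proof. by rewrite -normCK cabsE rmorphXn. Qed.

Lemma nrm_sqB x y (a : R[i]) : hdot x y = a * (nrm y ^+ 2)%:C ->
  nrm (x - a *: y) ^+ 2 = nrm x ^+ 2 - cabs a ^+ 2 * nrm y ^+ 2.
Proof.
move=> xy; apply: (@complexI R); rewrite -hdot_nrm.
rewrite hdotBl !hdotBr !hdotZl !hdotZr !hdot_nrm (hdotC y x) xy.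
rewrite conjMR.
rewrite subrr subr0 mulrA (mulrC (Num.conj a)) mul_conj_cabs.
by rewrite -rmorphM -rmorphB.
Qed.

End HilbertNorm.

Section Projection.
Context (R : realType) (H : hilbertType R) (M : closed_subspace H).
Implicit Types x y z w : H.

Lemma csubD x y : csub_set M x -> csub_set M y -> csub_set M (x + y).
Proof.
have [_ L] := csub_submod M => Mx My.
have := L 1 x y; rewrite !inE scale1r; exact.
Qed.

Lemma csub0 : csub_set M 0.
Proof. by have [+ _] := csub_submod M; rewrite inE. Qed.

Lemma csubZ a x : csub_set M x -> csub_set M (a *: x).
Proof.
have [_ L] := csub_submod M => Mx.
by have := L a x 0; rewrite !inE addr0; apply => //; exact: csub0.
Qed.

Lemma csubB x y : csub_set M x -> csub_set M y -> csub_set M (x - y).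
Proof. by move=> Mx My; rewrite -scaleN1r; apply/csubD => //; exact: csubZ. Qed.

(** Were [x - z] far from orthogonal to some [w] in [M], moving [z] along [w]
    would bring it closer to [x] than the distance to [M] allows. *)
Lemma near_minimizer_ortho x z w (d e : R) : 0 <= e ->
    (forall y, csub_set M y -> d <= nrm (x - y) ^+ 2) ->
    csub_set M z -> nrm (x - z) ^+ 2 <= d + e ^+ 2 -> csub_set M w ->
  cabs (hdot (x - z) w) <= e * nrm w.
Proof.
move=> e0 dM Mz ze Mw.
have [w0|w0] := eqVneq (nrm w) 0.
  by apply: le_trans (cabs_hdot _ _) _; rewrite w0 !mulr0.
pose a := hdot (x - z) w / (nrm w ^+ 2)%:C.
have ww0 : (nrm w ^+ 2)%:C != 0 :> R[i] by rewrite fmorph_eq0 expf_neq0.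
have xzw : hdot (x - z) w = a * (nrm w ^+ 2)%:C by rewrite divfK.
have := dM (z + a *: w) (csubD Mz (csubZ a Mw)).
rewrite opprD addrA nrm_sqB// => le_d.
have aw : cabs a * nrm w <= e.
  rewrite -(@ler_pXn2r _ 2) ?nnegrE ?mulr_ge0 ?cabs_ge0 ?nrm_ge0// exprMn.
  lra.
rewrite xzw cabsM cabsR ger0_norm ?sqr_ge0// expr2 mulrA.
by rewrite ler_wpM2r ?nrm_ge0.
Qed.

(** Near-minimisers of the distance to [x] form a Cauchy filter base, because
    their differences are almost orthogonal to themselves. *)
Lemma projection_exists x : exists2 p, csub_set M p &
  forall y, csub_set M y -> hdot (x - p) y = 0.
Proof.
pose D := [set nrm (x - y) ^+ 2 | y in csub_set M].
have D0 : D !=set0 by exists (nrm (x - 0) ^+ 2), 0 => //; exact: csub0.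
have Dlb : has_lbound D by exists 0 => _ [y _ <-]; exact: sqr_ge0.
have infD : has_inf D by [].
pose d := inf D.
have dM y : csub_set M y -> d <= nrm (x - y) ^+ 2.
  by move=> My; apply: ge_inf => //; exists y.
pose N (e : R) := [set z | csub_set M z /\ nrm (x - z) ^+ 2 <= d + e ^+ 2].
have N0 e : 0 < e -> N e !=set0.
  move=> e0; have [_ [y My <-] ylt] := inf_adherent (exprn_gt0 2 e0) infD.
  by exists y; split => //; exact: ltW.
have Nle e e' : 0 <= e -> e <= e' -> N e `<=` N e'.
  move=> e0 ee' z [Mz ze]; split => //; apply: le_trans ze _.
  by rewrite lerD2l ler_pXn2r// ?nnegrE// (le_trans e0).
pose G := filter_from [set e : R | 0 < e] N.
have FG : Filter G.
  apply: filter_from_filter; first by exists 1; exact: ltr01.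
  move=> e e' e0 e'0; exists (Num.min e e').
    by rewrite /= lt_min e0.
  have m0 : 0 <= Num.min e e' by rewrite le_min !ltW.
  by move=> z Nz; split; apply: Nle Nz; rewrite // ge_min lexx ?orbT.
have PG : ProperFilter G by apply: filter_from_proper.
have Ndist e z z' : 0 < e -> N e z -> N e z' -> nrm (z - z') <= e + e.
  move=> e0 [Mz ze] [Mz' ze'].
  have Mzz : csub_set M (z - z') by apply: csubB.
  have [z0|z0] := eqVneq (nrm (z - z')) 0; first by rewrite z0 addr_ge0// ltW.
  have : cabs (hdot (z - z') (z - z')) <= (e + e) * nrm (z - z').
    rewrite {1}(_ : z - z' = (x - z') - (x - z)); last by rewrite opprB [RHS]addrC addrA subrK.
    rewrite hdotBl mulrDl; apply: le_trans (nrmD _ _) _; rewrite nrmN.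
    by apply: lerD; apply: (near_minimizer_ortho (ltW e0) dM).
  rewrite hdot_nrm cabsR ger0_norm ?sqr_ge0// expr2 ler_pM2r//.
  by rewrite lt_neqAle eq_sym z0 nrm_ge0.
have /cauchy_cvg/cvg_ex[p Gp] : cauchy G.
  apply/cauchyP => e e0; have eE : e = (complex.Re e)%:C.
    by rewrite RRe_real// gtr0_real.
  have r0 : 0 < complex.Re e by rewrite -ltcR -eE.
  have r3 : 0 < complex.Re e / 3 by lra.
  have [z Nz] := N0 _ r3.
  exists z; exists (complex.Re e / 3) => // z' Nz'.
  rewrite -ball_normE /ball_ /= nrmE eE ltcR.
  by apply: le_lt_trans (Ndist _ _ _ r3 Nz Nz') _; lra.
have Mp : csub_set M p.
  have GM : G (csub_set M) by exists 1 => [|z []//]; exact: ltr01.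
  exact: (closed_cvg (csub_set M) (@csub_closed _ _ M) GM p Gp).
exists p => // y My.
suff : cabs (hdot (x - p) y) <= 0.
  by move=> h; apply: (@nrm0_eq0 _ R[i]^o); apply/eqP; rewrite eq_le h nrm_ge0.
apply/ler_addgt0Pr => e e0; rewrite add0r.
have y0 : 0 < nrm y + 1 by rewrite ltr_wpDl// nrm_ge0.
pose f := e / (nrm y + 1) / 2.
have f0 : 0 < f by rewrite !divr_gt0.
have /nrm_cvgP/(_ f f0) pf : id @ G --> p by [].
have : G (N f) by exists f.
move=> /(filterI pf)/(@filter_ex _ _ PG)[z [zp Nz]].
rewrite (_ : x - p = (x - z) - (p - z)); last by rewrite opprB addrA subrK.
rewrite hdotBl; apply: le_trans (nrmD _ _) _; rewrite nrmN.
apply: (@le_trans _ _ (f * nrm y + f * nrm y)); last first.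
  have fy : f * nrm y = e / 2 - f by rewrite /f; field; rewrite gt_eqF.
  by rewrite fy; lra.
apply: lerD.
  by have [Mz ze] := Nz; exact: (near_minimizer_ortho (ltW f0) dM).
apply: le_trans (cabs_hdot _ _) _.
by rewrite ler_wpM2r ?nrm_ge0// ltW.
Qed.

Lemma csub_valP (p : M) : csub_set M (csub_val p).
Proof. by have := valP (p : csub_type M); rewrite /csub_pred !inE. Qed.

Lemma csub_val_ex y : csub_set M y -> exists p : M, csub_val p = y.
Proof.
move=> My; have My' : y \in csub_pred M by rewrite /csub_pred !inE.
by exists (Sub y My' : csub_type M).
Qed.

Lemma csub_val_linear : linear (@csub_val _ _ M).
Proof. by move=> a u v; exact: (linearP (val : csub_type M -> H)). Qed.

Lemma hdot_csub_val (u v : M) : hdot (csub_val u) (csub_val v) = hdot u v.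
Proof. by []. Qed.

Lemma projP x (y : M) : hdot (csub_val (Defs.proj M x)) (csub_val y) = hdot x (csub_val y).
Proof.
apply/esym/subr0_eq; rewrite -hdotBl; rewrite /Defs.proj.
case: xgetP => [p -> /(_ y)//|none].
have [p Mp xp] := projection_exists x; have [p' pE] := csub_val_ex Mp.
case: (none p') => z /=.
by rewrite pE; apply: xp; exact: csub_valP.
Qed.

Lemma compressP A (x y : M) :
  hdot (compress M A x) y = hdot (A (csub_val x)) (csub_val y).
Proof. by rewrite -projP. Qed.

End Projection.

Section Riesz.
Context (R : realType) (H : hilbertType R) (f : H -> R[i]).
Hypothesis f_linear : forall a x y, f (a *: x + y) = a * f x + f y.
Hypothesis f_bounded : exists c : R, forall x, cabs (f x) <= c * nrm x.

Let f0 : f 0 = 0.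
Proof. by have := f_linear (-1) 0 0; rewrite scaleN1r addNr mulN1r addNr. Qed.

Let fB x y : f (x - y) = f x - f y.
Proof. by have := f_linear (-1) y x; rewrite scaleN1r mulN1r addrC => ->; rewrite addrC. Qed.

Let fZ a x : f (a *: x) = a * f x.
Proof. by rewrite -[a *: x]addr0 f_linear f0 addr0. Qed.

Let K : set H := [set x | f x = 0].

Let K_submod : submod_closed [pred x | x \in K].
Proof.
split=> [|a u v]; rewrite !inE /=; first exact: f0.
by rewrite /K /= f_linear => -> ->; rewrite mulr0 addr0.
Qed.

Let K_closed : closed K.
Proof.
move=> x cx /=; have [c fc] := f_bounded.
apply: (@nrm0_eq0 _ R[i]^o); apply/eqP; rewrite eq_le nrm_ge0 andbT.
apply/ler_addgt0Pr => e e0; rewrite add0r.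
have c0 : 0 < `|c| + 1 by rewrite ltr_wpDl.
have d0 : 0 < (e / (`|c| + 1))%:C by rewrite ltcR divr_gt0.
have [z [fz]] := cx _ (nbhsx_ballx x _ d0).
rewrite -ball_normE /= nrmE ltcR => xz.
rewrite -[f x]subr0 -[X in _ - X]fz -fB -/(cabs _).
apply: le_trans (fc _) _.
have cc : c <= `|c| + 1 by apply: le_trans (ler_norm c) _; rewrite lerDl.
apply: le_trans (ler_wpM2r (nrm_ge0 _) cc) _.
by rewrite mulrC -ler_pdivlMr// ltW.
Qed.

(** The representing vector is a multiple of any vector orthogonal to the kernel. *)
Lemma riesz : exists y, forall x, f x = hdot x y.
Proof.
have [fz|] := pselect (forall x, f x = 0).
  by exists 0 => x; rewrite hdot0r fz.
move=> /existsNP[x0 /eqP fx0].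
have [p Kp pK] := projection_exists (ClosedSubspace K_submod K_closed) x0.
set z := x0 - p in pK.
have fz : f z != 0 by rewrite fB Kp subr0.
have z0 : (nrm z ^+ 2)%:C != 0 :> R[i].
  rewrite -hdot_nrm; apply: contra fz => /eqP/hdot_eq0 ->.
  by rewrite f0.
exists ((Num.conj (f z) * ((nrm z ^+ 2)^-1)%:C) *: z) => x.
have : hdot (x - (f x / f z) *: z) z = 0.
  rewrite hdotC pK ?rmorph0// /csub_set /K /=.
  by rewrite fB fZ divfK// subrr.
rewrite hdotBl hdotZl hdot_nrm => /eqP; rewrite subr_eq0 => /eqP xz.
rewrite hdotZr xz conjMR conjCK realCV.
by move: ((nrm z ^+ 2)%:C) z0 => N N0; field; rewrite fz.
Qed.

End Riesz.

(** * Bounded operators *)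

Section Linear.
Context (R : realType) (U V : lmodType R[i]) (A : U -> V).
Hypothesis linA : linear A.

Lemma linD x y : A (x + y) = A x + A y.
Proof. by have := linA 1 x y; rewrite !scale1r. Qed.

Lemma lin0 : A 0 = 0.
Proof. by have := linA (-1) 0 0; rewrite !scaleN1r !addNr. Qed.

Lemma linZ a x : A (a *: x) = a *: A x.
Proof. by rewrite -[a *: x]addr0 linA lin0 addr0. Qed.

Lemma linB x y : A (x - y) = A x - A y.
Proof. by rewrite linD -scaleN1r linZ scaleN1r. Qed.

Lemma lin_sum (I : Type) (r : seq I) (P : pred I) (f : I -> U) :
  A (\sum_(i <- r | P i) f i) = \sum_(i <- r | P i) A (f i).
Proof. by apply: (big_morph A) => [u v|]; [exact: linD|exact: lin0]. Qed.

End Linear.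

Section Bounded.
Context (R : realType).
Implicit Types H K L : hilbertType R.

Lemma bounded_opP H K (A : H -> K) : bounded_op A <->
  linear A /\ exists2 c : R, 0 <= c & forall x, nrm (A x) <= c * nrm x.
Proof.
split=> [[linA [c cA]]|[linA [c c0 cA]]]; split=> //.
  exists (cabs c); first exact: cabs_ge0.
  move=> x; rewrite -lecR realCM -cabsE -!nrmE -[X in _ * X]normr_id -normrM.
  by apply: le_trans (cA x) _; rewrite real_ler_norm// ger0_real// (le_trans _ (cA x)).
by exists c%:C => x; rewrite !nrmE -realCM lecR.
Qed.

Lemma bounded_lin H K (A : H -> K) : bounded_op A -> linear A.
Proof. by case. Qed.

Lemma bounded_idfun H : @bounded_op R H H idfun.
Proof. by split=> //; exists 1 => x; rewrite mul1r. Qed.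

Lemma bounded_comp H K L (A : K -> L) (B : H -> K) :
  bounded_op A -> bounded_op B -> bounded_op (A \o B).
Proof.
move=> /bounded_opP[lA [a a0 aA]] /bounded_opP[lB [b b0 bB]].
apply/bounded_opP; split=> [c x y|]; first by rewrite /= lB lA.
exists (a * b) => [|x /=]; first exact: mulr_ge0.
by apply: le_trans (aA _) _; rewrite -mulrA ler_wpM2l.
Qed.

Lemma bounded_comb H K (a : R[i]) (A B : H -> K) :
  bounded_op A -> bounded_op B -> bounded_op (a *: A + B).
Proof.
move=> /bounded_opP[lA [c c0 cA]] /bounded_opP[lB [d d0 dB]].
apply/bounded_opP; split=> [e x y|].
  rewrite !fctE lA lB !scalerDr !scalerA (mulrC a) -!addrA; congr (_ + _).
  by rewrite addrCA.
exists (cabs a * c + d) => [|x]; first by rewrite addr_ge0// mulr_ge0// cabs_ge0.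
rewrite !fctE mulrDl; apply: le_trans (nrmD _ _) _.
by apply: lerD => //; rewrite nrmZ -mulrA ler_wpM2l// cabs_ge0.
Qed.

Lemma bounded_cst0 H K : bounded_op (cst 0 : H -> K).
Proof.
split=> [a x y|]; first by rewrite /= scaler0 addr0.
by exists 0 => x; rewrite /= normr0 mul0r.
Qed.

Lemma bounded_sum H K (I : Type) (r : seq I) (P : pred I) (c : I -> R[i])
    (A : I -> H -> K) : (forall i, bounded_op (A i)) ->
  bounded_op (\sum_(i <- r | P i) c i *: A i).
Proof.
move=> bA; elim/big_rec: _ => [|i B _ bB]; first exact: bounded_cst0.
exact: bounded_comb.
Qed.

Lemma adj_eq H K (A : H -> K) B :
  (forall x y, hdot (A x) y = hdot x (B y)) -> adj A = B.
Proof.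
move=> AB; rewrite /adj; case: xgetP => [C _ AC|/(_ B)//].
by apply/funext => y; apply: hdot_injr => x; rewrite -AC -AB.
Qed.

Lemma adj_id H : adj (idfun : H -> H) = idfun.
Proof. exact: adj_eq. Qed.

Lemma adjP H K (A : H -> K) : bounded_op A ->
  forall x y, hdot (A x) y = hdot x (adj A y).
Proof.
move=> /bounded_opP[lA [c c0 cA]].
have ex y : exists z, forall x, hdot (A x) y = hdot x z.
  apply: riesz => [a u v|]; first by rewrite lA hdotDl hdotZl.
  exists (c * nrm y) => x; apply: le_trans (cabs_hdot _ _) _.
  by rewrite mulrAC ler_wpM2r// nrm_ge0.
have [B AB] := choice ex.
by move=> x y; rewrite (adj_eq (B := B))// => u v; exact: AB.
Qed.

Lemma adjPr H K (A : H -> K) : bounded_op A ->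
  forall x y, hdot y (A x) = hdot (adj A y) x.
Proof. by move=> bA x y; rewrite hdotC adjP// -hdotC. Qed.

Lemma nrm_hdot H (x : H) (c : R) :
  0 <= c -> (forall y, cabs (hdot x y) <= c * nrm y) -> nrm x <= c.
Proof.
move=> c0 cx; have [->//|x0] := eqVneq (nrm x) 0.
have := cx x; rewrite hdot_nrm cabsR ger0_norm ?sqr_ge0// expr2 ler_pM2r//.
by rewrite lt_neqAle eq_sym x0 nrm_ge0.
Qed.

Lemma adj_bounded H K (A : H -> K) : bounded_op A -> bounded_op (adj A).
Proof.
move=> bA; have /bounded_opP[lA [c c0 cA]] := bA.
apply/bounded_opP; split=> [a u v|].
  by apply: hdot_injr => x; rewrite -adjP// !(hdotDr, hdotZr) -!adjP.
exists c => // y; apply: nrm_hdot => [|x]; first by rewrite mulr_ge0// nrm_ge0.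
rewrite -adjPr//; apply: le_trans (cabs_hdot _ _) _.
by rewrite -mulrA mulrCA ler_wpM2l ?nrm_ge0// (le_trans (cA x))// mulrC.
Qed.

Lemma adj_comp H K L (A : K -> L) (B : H -> K) :
  bounded_op A -> bounded_op B -> adj (A \o B) = adj B \o adj A.
Proof. by move=> bA bB; apply: adj_eq => x y; rewrite /= !adjP. Qed.

Lemma total_ortho H (G : set H) : closure (lspan G) = setT ->
  forall y, (forall x, G x -> hdot x y = 0) -> y = 0.
Proof.
move=> GT y Gy; apply: hdot_eq0.
have sub : lspan G `<=` ortho_set [set y].
  move=> _ [r [c [v [Gv ->]]]] _ -> ; rewrite hdot_suml big1// => l _.
  by rewrite hdotZl Gy ?mulr0.
have : closure (lspan G) y by rewrite GT.
move=> /(closureS sub); have /closure_id <- := @ortho_closed _ _ [set y].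
exact.
Qed.

Lemma bounded_eq_total H K (G : set H) (A B : H -> K) :
  closure (lspan G) = setT -> bounded_op A -> bounded_op B ->
  (forall x, G x -> A x = B x) -> A = B.
Proof.
move=> GT bA bB AB; apply/funext => x; apply: hdot_inj => y.
rewrite !adjP//; suff -> : adj A y = adj B y by [].
apply/subr0_eq/(total_ortho GT) => z Gz.
by rewrite hdotBr -!adjP// AB// subrr.
Qed.

Lemma wordop_cons T (l : nat) (X : 'I_l -> T -> T) j a :
  wordop X (j :: a) = X j \o wordop X a.
Proof. by []. Qed.

Lemma bounded_wordop H (l : nat) (X : 'I_l -> H -> H) (a : seq 'I_l) :
  (forall j, bounded_op (X j)) -> bounded_op (wordop X a).
Proof.
move=> bX; elim: a => [|j a IH]; first exact: bounded_idfun.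
by rewrite wordop_cons; exact: bounded_comp.
Qed.

Lemma bounded_mwordop H (k : nat) (n : 'I_k -> nat) (X : optuple n H)
  (b : mword n) : (forall i j, bounded_op (X i j)) -> bounded_op (mwordop X b).
Proof.
move=> bX; rewrite /mwordop; elim: (enum _) => [|i s IH]; first exact: bounded_idfun.
by apply: bounded_comp => //; exact: bounded_wordop.
Qed.

End Bounded.

(** * Orthonormal bases *)

Section FsetFilter.
Context (T : choiceType).

Definition fset_filter : set_system {fset T} :=
  filter_from setT (fun A => [set B | (A `<=` B)%fset]).

Global Instance fset_filter_proper : ProperFilter fset_filter.
Proof.
apply: filter_from_proper => [|A _]; last by exists A; exact: fsubset_refl.
apply: filter_from_filter => [|A B _ _]; first by exists fset0.
exists (A `|` B)%fset => // C; rewrite /= fsubUset => /andP[]; by [].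
Qed.

Lemma fset_filter_ge (A : {fset T}) : \forall B \near fset_filter, (A `<=` B)%fset.
Proof. by exists A. Qed.

End FsetFilter.
Arguments fset_filter : clear implicits.

(** An orthonormal family is a basis as soon as no nonzero vector is orthogonal
    to it; this form is easier to transfer to tensor products than density. *)
Definition complete_orthonormal (R : realType) (H : hilbertType R) (T : eqType)
    (e : T -> H) : Prop :=
  (forall a b, hdot (e a) (e b) = (a == b)%:R) /\
  (forall x, (forall t, hdot x (e t) = 0) -> x = 0).

Section Orthonormal.
Context (R : realType) (H : hilbertType R) (T : choiceType) (e : T -> H).
Hypothesis e_onb : complete_orthonormal e.
Implicit Types (x y : H) (B : {fset T}) (c : T -> R[i]).

Definition fcomb c B : H := \sum_(t <- B) c t *: e t.

Lemma onb_dot a b : hdot (e a) (e b) = (a == b)%:R.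
Proof. by case: e_onb. Qed.

Lemma onb_eq x y : (forall t, hdot x (e t) = hdot y (e t)) -> x = y.
Proof.
have [_ sep] := e_onb => xy; apply/subr0_eq/sep => t.
by rewrite hdotBl xy subrr.
Qed.

Lemma nrm_onb t : nrm (e t) = 1.
Proof.
have := onb_dot t t; rewrite eqxx hdot_nrm => /(@complexI R _ 1)/eqP.
by rewrite sqrp_eq1 ?nrm_ge0// => /eqP.
Qed.

Lemma hdot_fcomb c B u : hdot (fcomb c B) (e u) = if u \in B then c u else 0.
Proof.
rewrite hdot_suml; case: ifPn => uB.
  rewrite (big_fsetD1 u)//= hdotZl onb_dot eqxx mulr1 big1_fset ?addr0// => t.
  by rewrite !inE => /andP[/negbTE tu _] _; rewrite hdotZl onb_dot tu mulr0.
rewrite big1_seq// => t /andP[_ tB]; rewrite hdotZl onb_dot.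
by case: eqVneq tB uB => [-> ->|_ _]; rewrite ?mulr0.
Qed.

Lemma nrm_fcomb c B : nrm (fcomb c B) ^+ 2 = \sum_(t <- B) cabs (c t) ^+ 2.
Proof.
apply: (@complexI R); rewrite -hdot_nrm realC_sum {2}/fcomb hdot_sumr.
rewrite big_seq [RHS]big_seq; apply: eq_bigr => t tB.
by rewrite hdotZr hdot_fcomb tB mulrC mul_conj_cabs.
Qed.

Lemma hdot_fcombr c x B : (forall t, t \in B -> hdot x (e t) = c t) ->
  hdot x (fcomb c B) = 1 * (nrm (fcomb c B) ^+ 2)%:C.
Proof.
move=> xc; rewrite mul1r -hdot_nrm {1 3}/fcomb !hdot_sumr.
rewrite big_seq [RHS]big_seq; apply: eq_bigr => t tB.
by rewrite !hdotZr hdot_fcomb tB xc.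
Qed.

Lemma nrm_sqB_fcomb c x B : (forall t, t \in B -> hdot x (e t) = c t) ->
  nrm (x - fcomb c B) ^+ 2 = nrm x ^+ 2 - nrm (fcomb c B) ^+ 2.
Proof.
move=> /hdot_fcombr/nrm_sqB; rewrite scale1r => ->.
by rewrite (_ : cabs 1 = 1) ?expr1n ?mul1r// -[1]/(1%:C) cabsR normr1.
Qed.

Lemma bessel x B : nrm (fcomb (fun t => hdot x (e t)) B) <= nrm x.
Proof.
rewrite -(@ler_pXn2r _ 2) ?nnegrE ?nrm_ge0//.
by rewrite -subr_ge0 -nrm_sqB_fcomb// sqr_ge0.
Qed.

(** The squared norms of the partial sums increase to a supremum; a finite set
    that almost reaches it controls all larger partial sums. *)
Theorem riesz_fischer c (K : R) : 0 <= K -> (forall B, nrm (fcomb c B) <= K) ->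
  exists y, [/\ forall t, hdot y (e t) = c t, nrm y <= K &
                fcomb c B @[B --> fset_filter T] --> y].
Proof.
move=> K0 cK.
pose D := [set nrm (fcomb c B) ^+ 2 | B in setT].
have supD : has_sup D.
  split; first by exists (nrm (fcomb c fset0) ^+ 2), fset0.
  by exists (K ^+ 2) => _ [B _ <-]; rewrite ler_pXn2r// nnegrE nrm_ge0.
have near_e (r : R) : 0 < r -> exists B, forall C, (B `<=` C)%fset ->
    nrm (fcomb c B - fcomb c C) < r.
  move=> r0; have [_ [B _ <-] ltB] := sup_adherent (exprn_gt0 2 r0) supD.
  exists B => C BC; rewrite nrmB.
  rewrite -(@ltr_pXn2r _ 2) ?nnegrE ?nrm_ge0 ?(ltW r0)//.
  have leC : nrm (fcomb c C) ^+ 2 <= sup D.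
    by apply: (ub_le_sup supD.2); exists C.
  rewrite nrm_sqB_fcomb; first by lra.
  by move=> t tB; rewrite hdot_fcomb (fsubsetP BC).
have /cauchy_cvg/cvg_ex[y cy] : cauchy (fcomb c B @[B --> fset_filter T]).
  apply/cauchyP => r r0; have rE : r = (complex.Re r)%:C.
    by rewrite RRe_real// gtr0_real.
  have [B Br] := near_e (complex.Re r) ltac:(by rewrite -ltcR -rE).
  exists (fcomb c B); exists B => // C BC.
  by rewrite /= -ball_normE /ball_ /= nrmE rE ltcR; exact: Br.
have near_y (r : R) : 0 < r -> \forall B \near fset_filter T, nrm (y - fcomb c B) < r.
  by move=> r0; move/nrm_cvgP : cy; exact.
exists y; split => // [t|].
  apply/subr0_eq/(@nrm0_eq0 _ R[i]^o)/eqP; rewrite eq_le nrm_ge0 andbT.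
  apply/ler_addgt0Pr => r r0; rewrite add0r.
  have /(filterI (near_y r r0))/filter_ex[B [yB tB]] := fset_filter_ge [fset t]%fset.
  have tB' : t \in B by rewrite -fsub1set.
  have -> : hdot y (e t) - c t = hdot (y - fcomb c B) (e t).
    by rewrite hdotBl hdot_fcomb tB'.
  apply: le_trans (cabs_hdot _ _) _.
  by rewrite nrm_onb mulr1 ltW.
apply/ler_addgt0Pr => r r0; have /filter_ex[B yB] := near_y r r0.
rewrite -(subrK (fcomb c B) y); apply: le_trans (nrmD _ _) _.
by rewrite addrC lerD//; exact: ltW.
Qed.

Definition coords x : T -> R[i] := fun t => hdot x (e t).

Lemma onb_expansion x : fcomb (coords x) B @[B --> fset_filter T] --> x.
Proof.
have [y [xy _ cy]] := riesz_fischer (nrm_ge0 x) (bessel x).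
by move: cy; rewrite (onb_eq xy).
Qed.

Lemma onb_approx x (r : R) : 0 < r -> exists B, nrm (x - fcomb (coords x) B) < r.
Proof.
move=> r0; move/nrm_cvgP : (onb_expansion (x := x)) => /(_ r r0)/filter_ex[B].
by exists B.
Qed.

Lemma coords_nrm_le c (k : R) y : 0 <= k ->
  (forall t, cabs (c t) <= k * cabs (hdot y (e t))) ->
  forall B, nrm (fcomb c B) <= k * nrm y.
Proof.
move=> k0 xy B.
apply: (@le_trans _ _ (k * nrm (fcomb (coords y) B))); last first.
  by rewrite ler_wpM2l ?bessel.
rewrite -(@ler_pXn2r _ 2) ?nnegrE ?mulr_ge0 ?nrm_ge0// exprMn !nrm_fcomb mulr_sumr.
apply: ler_sum => t _; rewrite -exprMn.
by rewrite ler_pXn2r ?nnegrE ?mulr_ge0 ?cabs_ge0.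
Qed.

Lemma nrm_le_coords x y (k : R) : 0 <= k ->
  (forall t, cabs (hdot x (e t)) <= k * cabs (hdot y (e t))) ->
  nrm x <= k * nrm y.
Proof.
move=> k0 xy.
have [|z [zx zK _]] := riesz_fischer _ (coords_nrm_le k0 xy).
  by rewrite mulr_ge0 ?nrm_ge0.
by rewrite (onb_eq (x := x) (y := z)).
Qed.

(** Coordinates damped by factors in [[0, 1]] that tend to [1] one at a time
    converge in norm: finitely many coordinates carry almost all of [x], and the
    others are dominated by those of the tail of [x]. *)
Lemma multiplier_cvg (I : Type) (F : set_system I) (FF : Filter F) (y : I -> H) x
    (l : I -> T -> R) :
  (\forall s \near F, forall t, hdot (y s) (e t) = (l s t)%:C * hdot x (e t)) ->
  (\forall s \near F, forall t, 0 <= l s t <= 1) ->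
  (forall t (r : R), 0 < r -> \forall s \near F, 1 - r <= l s t) ->
  y @ F --> x.
Proof.
move=> yx l01 l1; apply/nrm_cvgP => r r0.
have [B xB] := onb_approx x (divr_gt0 r0 (ltr0n R 2)).
pose K := \sum_(t <- B) cabs (hdot x (e t)).
have K0 : 0 <= K by apply: sumr_ge0 => t _; exact: cabs_ge0.
pose d := r / 2 / (K + 1).
have d0 : 0 < d by rewrite !divr_gt0// ltr_wpDl.
have lB : F (\bigcap_(t in [set` B]) [set s | 1 - d <= l s t]).
  by apply: filter_bigI => t _; exact: l1.
apply: filterS (filterI lB (filterI l01 yx)) => s [lsB [ls01 ysx]].
pose z := x - y s; pose z1 := fcomb (coords z) B.
have zE t : hdot z (e t) = (1 - l s t)%:C * hdot x (e t).
  by rewrite hdotBl ysx rmorphB mulrBl mul1r.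
have absz t : cabs (hdot z (e t)) = (1 - l s t) * cabs (hdot x (e t)).
  rewrite zE cabsM cabsR ger0_norm// subr_ge0.
  by case/andP: (ls01 t).
rewrite -/z -(subrK z1 z) [r]splitr; apply: le_lt_trans (nrmD _ _) _.
apply: ltr_leD.
  apply: le_lt_trans xB; rewrite -[leRHS]mul1r; apply: nrm_le_coords => // t.
  rewrite mul1r !(hdotBl _ (fcomb _ _)) !hdot_fcomb; case: ifPn => _.
    by rewrite /coords !subrr.
  rewrite !subr0 absz ler_piMl ?cabs_ge0//.
  by have := ls01 t; lra.
apply: le_trans (nrm_sum _ _ _) _.
apply: (@le_trans _ _ (d * K)); last first.
  rewrite /d -mulrA ler_piMr//; first by rewrite divr_ge0// ltW.
  by rewrite mulrC ler_pdivrMr ?mul1r ?lerDl// ltr_wpDl.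
rewrite /K mulr_sumr big_seq [leRHS]big_seq; apply: ler_sum => t tB.
rewrite nrmZ nrm_onb mulr1 absz ler_wpM2r ?cabs_ge0//.
by have := lsB t tB; rewrite /=; lra.
Qed.

(** Nonnegative reals form a closed subset of [R[i]]. *)
Lemma ge0_cvg (z : R[i]) :
  (forall r : R, 0 < r -> exists2 p : R, 0 <= p & cabs (z - p%:C) <= r) -> 0 <= z.
Proof.
move=> zp; rewrite lecE /=; apply/andP; split.
  apply/eqP/normr0_eq0/eqP; rewrite eq_le normr_ge0 andbT.
  apply/ler_addgt0Pr => r r0; rewrite add0r.
  have [p p0] := zp r r0; apply: le_trans.
  rewrite -lecR -cabsE; case: z {zp} => a b /=.
  by rewrite normc_def /= subr0 lecR -sqrtr_sqr ler_wsqrtr// lerDr sqr_ge0.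
rewrite -oppr_le0; apply/ler_addgt0Pr => r r0; rewrite add0r.
have [p p0 zr] := zp r r0.
have : `|complex.Re (z - p%:C)| <= r.
  by rewrite -lecR (le_trans (normc_ge_Re _))// cabsE lecR.
rewrite raddfB /= ler_norml; lra.
Qed.

Lemma diag_ge0 (x v : H) (l : T -> R) : (forall t, 0 <= l t) ->
  (forall t, hdot v (e t) = (l t)%:C * hdot x (e t)) -> 0 <= hdot v x.
Proof.
move=> l0 vx; apply: ge0_cvg => r r0.
have v1 : 0 < nrm v + 1 by rewrite ltr_wpDl// nrm_ge0.
have [B xB] := onb_approx x (divr_gt0 r0 v1).
exists (\sum_(t <- B) l t * cabs (hdot x (e t)) ^+ 2).
  by apply: sumr_ge0 => t _; rewrite mulr_ge0// sqr_ge0.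
have -> : (\sum_(t <- B) l t * cabs (hdot x (e t)) ^+ 2)%:C =
    hdot v (fcomb (coords x) B).
  rewrite realC_sum hdot_sumr; apply: eq_bigr => t _.
  by rewrite hdotZr vx realCM -mul_conj_cabs [RHS]mulrCA [X in _ = _ * X]mulrC.
rewrite -hdotBr; apply: le_trans (cabs_hdot _ _) _.
apply: (@le_trans _ _ ((nrm v + 1) * (r / (nrm v + 1)))).
  by apply: ler_pM; rewrite ?nrm_ge0 ?lerDl// ltW.
by rewrite mulrC divfK// gt_eqF.
Qed.

(** A weighted partial shift of the index set acts boundedly: [tau u = Some t]
    says that the coordinate at [t] is moved to [u]. *)
Lemma weighted_shift_exists (tau : T -> option T) (w : T -> R) (K : R) :
  (forall u u' t, tau u = Some t -> tau u' = Some t -> u = u') ->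
  0 <= K -> (forall u, tau u -> `|w u| <= K) ->
  exists2 A : H -> H, bounded_op A & forall x u,
    hdot (A x) (e u) = if tau u is Some t then (w u)%:C * hdot x (e t) else 0.
Proof.
move=> tau_inj K0 wK.
pose c x u := if tau u is Some t then (w u)%:C * hdot x (e t) else 0.
have cB x B : nrm (fcomb (c x) B) <= K * nrm x.
  pose f u := odflt u (tau u); pose D := [fset u in B | tau u]%fset.
  have Df u : u \in D -> tau u = Some (f u).
    by rewrite !inE /f => /andP[_]; case: (tau u).
  pose C := [fset f u | u in D]%fset.
  apply: (@le_trans _ _ (K * nrm (fcomb (coords x) C))); last first.
    by rewrite ler_wpM2l ?bessel.
  rewrite -(@ler_pXn2r _ 2) ?nnegrE ?mulr_ge0 ?nrm_ge0// exprMn !nrm_fcomb.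
  rewrite [X in _ ^+ 2 * X]big_imfset/=; last first.
    move=> u u' /Df tu /Df tu' ff; apply: (tau_inj u u' (f u)) => //.
    by rewrite ff.
  rewrite -(big_fset_incl _ (A := D)); first last.
  - move=> u uB; rewrite !inE uB /c /=; case: (tau u) => // _.
    by rewrite /cabs nrm0 expr0n.
  - by apply/fsubsetP => u; rewrite !inE => /andP[].
  rewrite mulr_sumr big_seq [leRHS]big_seq; apply: ler_sum => u uD.
  rewrite /c (Df u uD) cabsM cabsR exprMn ler_wpM2r ?sqr_ge0//.
  by rewrite ler_pXn2r ?nnegrE// wK// Df.
have ex x : exists y, forall u, hdot y (e u) = c x u.
  have [|y [yc _ _]] := riesz_fischer _ (cB x); last by exists y.
  by rewrite mulr_ge0 ?nrm_ge0.
have [A AP] := choice ex; exists A => //.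
apply/bounded_opP; split=> [a x y|].
  apply: onb_eq => u; rewrite hdotDl hdotZl !AP /c.
  case: (tau u) => [t|]; last by rewrite mulr0 addr0.
  by rewrite hdotDl hdotZl mulrDr mulrCA.
exists K => // x.
have [|y [yc yK _]] := riesz_fischer _ (cB x); first by rewrite mulr_ge0 ?nrm_ge0.
by rewrite (onb_eq (x := A x) (y := y))// => u; rewrite AP yc.
Qed.

End Orthonormal.

(** * The weights of the shifts *)

Section Convolution.
Context (R : realType) (l : nat).
Implicit Types (a : seq 'I_l) (f : seq 'I_l -> R).

(** The product of noncommutative power series, on coefficients. *)
Definition conv f (g : seq 'I_l -> R) : seq 'I_l -> R :=
  fun a => \sum_(t < (size a).+1) f (take t a) * g (drop t a).

Definition qpow f p : seq 'I_l -> R := iter p (conv f) (fun a => (a == [::])%:R).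

Lemma conv_ge0 f g a : (forall b, 0 <= f b) -> (forall b, 0 <= g b) ->
  0 <= conv f g a.
Proof. by move=> f0 g0; apply: sumr_ge0 => t _; rewrite mulr_ge0. Qed.

Lemma qpow_ge0 f p a : (forall b, 0 <= f b) -> 0 <= qpow f p a.
Proof.
by move=> f0; elim: p a => [|p IH] a /=; [case: eqP|apply: conv_ge0].
Qed.

Lemma conv_eq0 f g (s : nat) a : f [::] = 0 ->
  (forall b, (size b < s)%N -> g b = 0) -> (size a <= s)%N -> conv f g a = 0.
Proof.
move=> f0 g0 sa; rewrite /conv big1// => -[[|t] /= lt_t] _.
  by rewrite take0 f0 mul0r.
rewrite g0 ?mulr0// size_drop; case: a sa lt_t => [|j a] //= sa _.
by rewrite subSS (leq_ltn_trans (leq_subr _ _)).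
Qed.

Lemma iter_conv_eq0 f g p a : f [::] = 0 -> (size a < p)%N ->
  iter p (conv f) g a = 0.
Proof.
move=> f0; elim: p a => //= p IH a.
by rewrite ltnS; apply: conv_eq0 => // b; exact: IH.
Qed.

Lemma sum_take (G : nat -> R) w a :
  \sum_(t < (size a).+1) (if w == take t a then G t else 0) =
  if prefix w a then G (size w) else 0.
Proof.
case: ifPn => [pwa|/negP pwa]; last first.
  rewrite big1// => t _; case: eqP => // wE; case: pwa.
  by rewrite wE prefix_take.
have lt_w : (size w < (size a).+1)%N by rewrite ltnS size_prefix.
rewrite (bigD1 (Ordinal lt_w))//= eq_sym -prefixE pwa big1 ?addr0// => t tw.
case: eqP => // wE; case/eqP: tw; apply: val_inj => /=.
by rewrite wE size_take_min; apply/esym/minn_idPl; rewrite -ltnS.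
Qed.

Lemma sum_finsupp_conv (q : ncpoly R l) f a :
  \sum_(w <- finsupp q) q w * (if prefix w a then f (drop (size w) a) else 0) =
  conv q f a.
Proof.
rewrite /conv; transitivity (\sum_(w <- finsupp q)
    \sum_(t < (size a).+1) if w == take t a then q w * f (drop t a) else 0).
  apply: eq_bigr => w _; rewrite (sum_take (fun t => q w * f (drop t a))).
  by case: ifP; rewrite ?mulr0.
rewrite exchange_big /=; apply: eq_bigr => t _.
have [qt|qt] := boolP (take t a \in finsupp q).
  rewrite (big_fsetD1 _ qt)/= eqxx big1_fset ?addr0// => w.
  by rewrite !inE => /andP[/negbTE ->].
rewrite big1_seq; first by rewrite fsfun_dflt ?mul0r.
by move=> w /andP[_ qw]; case: eqP => // wt; rewrite wt (negbTE qt) in qw.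
Qed.

(** As [q] vanishes on the empty word, empty factors contribute nothing to the
    convolution power. *)
Lemma sum_factorizations (q : ncpoly R l) (N p : nat) a : q [::] = 0 ->
    (size a <= N)%N ->
  \sum_(g : p.-tuple {bseq N of 'I_l} |
        (flatten [seq val w | w <- g] == a) &&
        all (fun w => 0 < size (val w))%N g)
    \prod_(w <- g) q (val w) = qpow q p a.
Proof.
move=> q0; elim: p a => [|p IH] a aN.
  rewrite /qpow /=; case: eqP => [->|a0].
    rewrite (big_pred1 [tuple])/= ?big_nil// => g.
    by rewrite tuple0 /= !eqxx.
  by rewrite big_pred0// => g; rewrite tuple0 /= andbT; apply/eqP => aE; exact: a0.
pose h (x : {bseq N of 'I_l} * p.-tuple {bseq N of 'I_l}) := [tuple of x.1 :: x.2].
rewrite (reindex h)/=; last first.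
  exists (fun g : p.+1.-tuple _ => (thead g, [tuple of behead g])) => [[w g] _|g _].
    by congr (_, _); apply: val_inj.
  by apply: val_inj; rewrite /= -[LHS]/(val [tuple of _ :: _]) -tuple_eta.
rewrite -(pair_big_dep xpredT (fun (w : {bseq N of 'I_l})
   (g : p.-tuple {bseq N of 'I_l}) => (val w ++ flatten [seq val w | w <- g] == a)
    && ((0 < size (val w))%N && all (fun w => 0 < size (val w))%N g))
   (fun w g => \prod_(v <- [tuple of w :: g]) q (val v)))/=.
transitivity (\sum_(w : {bseq N of 'I_l})
   if prefix (val w) a then q (val w) * qpow q p (drop (size w) a) else 0).
  apply: eq_bigr => w _; have [w0|w0] := eqVneq (val w) [::].
    rewrite w0 q0 mul0r if_same big_pred0// => g.
    by rewrite w0 andbF.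
  case: ifPn => [/prefixP[v aE]|npa]; last first.
    rewrite big_pred0// => g; apply/negbTE; apply: contra npa => /andP[/eqP <- _].
    exact: prefix_prefix.
  rewrite aE drop_size_cat//= -IH; last first.
    by apply: leq_trans aN; rewrite aE size_cat leq_addl.
  rewrite mulr_sumr; apply: eq_big => [g|g _]; last by rewrite big_cons.
  by rewrite eqseq_cat// eqxx /= lt0n size_eq0 w0.
transitivity (\sum_(w : {bseq N of 'I_l}) \sum_(t < (size a).+1)
   if val w == take t a then q (take t a) * qpow q p (drop t a) else 0).
  apply: eq_bigr => w _.
  rewrite -(sum_take (fun t => q (val w) * qpow q p (drop t a))).
  by apply: eq_bigr => t _; case: eqP => // ->.
rewrite exchange_big /=; apply: eq_bigr => t _.
have tN : (size (take t a) <= N)%N by rewrite (leq_trans _ aN)// size_take_min geq_minr.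
rewrite (bigD1 (Bseq tN))//= eqxx big1 ?addr0// => w wt.
by case: eqP => // wE; case/eqP: wt; apply: val_inj.
Qed.

(** The coefficients of [1 / (1 - f)^m]. At [m = 0] the truncated subtraction
    leaves only the term [p = 0], as it should. *)
Definition bser f m a : R := \sum_(p < (size a).+1) 'C(p + m - 1, p)%:R * qpow f p a.

Lemma bcoefE (q : ncpoly R l) m a : q [::] = 0 -> (0 < m)%N ->
  bcoef q m a = bser q m a.
Proof.
move=> q0 m0; rewrite /bser -(big_mkord xpredT (fun p => 'C(p + m - 1, p)%:R * qpow q p a)).
rewrite big_ltn//; case: a => [|j a].
  by rewrite /= big_geq// addr0 bin0 mul1r.
rewrite /bcoef {1}/qpow /= mulr0 add0r; apply: eq_big_nat => p /andP[p0 pa].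
rewrite -(@sum_factorizations q (size (j :: a)))// mulr_sumr; apply: eq_bigr => g _.
rewrite mulrC; congr (_%:R * _); rewrite -[RHS]bin_sub; last first.
  by rewrite -addnBA// leq_addr.
by congr binomial; rewrite -addnBA// addKn.
Qed.

Lemma bser_widen f m a N : f [::] = 0 -> (size a < N)%N ->
  bser f m a = \sum_(p < N) 'C(p + m - 1, p)%:R * qpow f p a.
Proof.
move=> f0 aN; rewrite /bser (big_ord_widen _ (fun p => 'C(p + m - 1, p)%:R * qpow f p a) aN).
rewrite big_mkcond; apply: eq_bigr => p _; case: ltnP => // ap.
by rewrite /qpow iter_conv_eq0 ?mulr0.
Qed.

Lemma bser0 f a : bser f 0 a = (a == [::])%:R.
Proof.
rewrite /bser big_ord_recl /= add0n bin0 mul1r big1 ?addr0// => p _.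
by rewrite /bump /= addn0 add1n subn1 /= bin_small ?mul0r.
Qed.

(** [(1 - f) / (1 - f)^m.+1 = 1 / (1 - f)^m]: on the coefficients of the powers of
    [f], this is Pascal's rule. *)
Lemma bser_rec f m a : f [::] = 0 ->
  bser f m.+1 a - conv f (bser f m.+1) a = bser f m a.
Proof.
move=> f0.
have -> : conv f (bser f m.+1) a =
    \sum_(p < (size a).+1) 'C(p + m, p)%:R * qpow f p.+1 a.
  transitivity (\sum_(t < (size a).+1) \sum_(p < (size a).+1)
      'C(p + m, p)%:R * (f (take t a) * qpow f p (drop t a))).
    apply: eq_bigr => t _; rewrite (@bser_widen _ _ _ (size a).+1)//; last first.
      by rewrite ltnS size_drop leq_subr.
    by rewrite mulr_sumr; apply: eq_bigr => p _; rewrite mulrCA addnS subn1.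
  rewrite exchange_big /=; apply: eq_bigr => p _.
  by rewrite -mulr_sumr.
rewrite !(@bser_widen _ _ _ (size a).+2)// big_ord_recl [RHS]big_ord_recl /=.
rewrite !bin0 -addrA -sumrB; congr (_ + _); apply: eq_bigr => p _.
rewrite /bump /= !add1n !addSn addnS !subSS !subn0 binS natrD -mulrBl.
by rewrite addrK.
Qed.

Lemma bser_ge0 f m a : (forall b, 0 <= f b) -> 0 <= bser f m a.
Proof. by move=> f0; apply: sumr_ge0 => p _; rewrite mulr_ge0 ?qpow_ge0. Qed.

Lemma bser_nil f m : bser f m [::] = 1.
Proof. by rewrite /bser big_ord1 bin0 mul1r. Qed.

(** In [1 / (1 - f)^m.+1 = 1 / (1 - f)^m + f / (1 - f)^m.+1] all coefficients are
    nonnegative. This is what makes the shifts bounded. *)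
Lemma bser_cons_ge f m j a : f [::] = 0 -> (forall b, 0 <= f b) ->
  f [:: j] * bser f m.+1 a <= bser f m.+1 (j :: a).
Proof.
move=> f0 f_ge0; have := @bser_rec f m (j :: a) f0 => /eqP.
rewrite subr_eq => /eqP ->; rewrite ler_wpDl ?bser_ge0//.
rewrite /conv /= !big_ord_recl /= take0 drop0 f0 mul0r add0r lerDl.
by apply: sumr_ge0 => t _; rewrite mulr_ge0 ?bser_ge0.
Qed.

Lemma bser_gt0 f m a : f [::] = 0 -> (forall b, 0 <= f b) ->
  (forall j, 0 < f [:: j]) -> 0 < bser f m.+1 a.
Proof.
move=> f0 f_ge0 f1; elim: a => [|j a IH]; first by rewrite bser_nil.
by apply: lt_le_trans (bser_cons_ge _ _ _ f0 f_ge0); rewrite mulr_gt0.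
Qed.

(** Multiplying [1 / (1 - f)^m.+1] by [f] subtracts [1 / (1 - f)^m], hence
    decreases the coefficients. *)
Lemma iter_conv_bser f m s a : f [::] = 0 -> (forall b, 0 <= f b) ->
  0 <= iter s (conv f) (bser f m.+1) a <= bser f m.+1 a.
Proof.
move=> f0 f_ge0; elim: s a => [|s IH] a /=; first by rewrite bser_ge0 ?lexx.
apply/andP; split; first by apply: conv_ge0 => // b; case/andP: (IH b).
have := @bser_rec f m a f0 => /eqP.
rewrite subr_eq => /eqP ->; rewrite ler_wpDl ?bser_ge0//.
by apply: ler_sum => t _; rewrite ler_wpM2l//; case/andP: (IH (drop t a)).
Qed.

End Convolution.

(** * Multi-indices and tensor products of bases *)

Section MultiWords.
Context (k : nat) (n : 'I_k -> nat).
Implicit Types (a b d : mword n) (i : 'I_k).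

Definition mword0 : mword n := finfun (fun=> [::]).

Definition upd d i (w : seq 'I_(n i)) : mword n := finfun (dfwith d i w).
Arguments upd d i w : clear implicits.

Lemma upd_in d i w : upd d i w i = w.
Proof. by rewrite ffunE dfwithin. Qed.

Lemma upd_out d i w i' : i != i' -> upd d i w i' = d i'.
Proof. by move=> ii'; rewrite ffunE dfwithout. Qed.

Lemma mwordP a b : (forall i, a i = b i) -> a = b.
Proof. by move=> ab; apply/ffunP. Qed.

Lemma upd_id d i : upd d i (d i) = d.
Proof.
apply: mwordP => i'; have [<-|ii'] := eqVneq i i'; first by rewrite upd_in.
by rewrite upd_out.
Qed.

Lemma upd_upd d i (w w' : seq 'I_(n i)) : upd (upd d i w) i w' = upd d i w'.
Proof.
apply: mwordP => i'; have [<-|ii'] := eqVneq i i'; first by rewrite !upd_in.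
by rewrite !upd_out.
Qed.

Definition mcat a b : mword n := finfun (fun i => a i ++ b i).

Definition mprefix b d := [forall i, prefix (b i) (d i)].

Definition mdrop b d : mword n := finfun (fun i => drop (size (b i)) (d i)).

Lemma mprefix_cat a b : mprefix a (mcat a b).
Proof. by apply/forallP => i; rewrite ffunE prefix_prefix. Qed.

Lemma mdrop_cat a b : mdrop a (mcat a b) = b.
Proof. by apply: mwordP => i; rewrite !ffunE drop_size_cat. Qed.

Lemma mcat_drop b d : mprefix b d -> mcat b (mdrop b d) = d.
Proof.
move=> /forallP bd; apply: mwordP => i; rewrite !ffunE.
by have /prefixP[s ->] := bd i; rewrite drop_size_cat.
Qed.

Lemma mcat_injl a b c : mcat a c = mcat b c -> a = b.
Proof.
move=> /ffunP ab; apply: mwordP => i; have := ab i; rewrite !ffunE => /eqP.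
have := congr1 size (ab i); rewrite !ffunE !size_cat => /addIn sab.
by rewrite eqseq_cat// => /andP[/eqP].
Qed.

Lemma mcat0 b : mcat b mword0 = b.
Proof. by apply: mwordP => i; rewrite !ffunE cats0. Qed.

Lemma mlength_cat a b : mlength (mcat a b) = (mlength a + mlength b)%N.
Proof.
rewrite /mlength -big_split; apply: eq_bigr => i _ /=.
by rewrite ffunE size_cat.
Qed.

End MultiWords.
Arguments upd {k n} d i w.

Section TensorBasis.
Context (R : realType).

Lemma fock_onb l (F : fock_space R l) : complete_orthonormal (fock_basis F).
Proof.
have [dots tot] := fock_basisP F; split => // x xe.
apply: (total_ortho tot) => _ [a _ <-].
by rewrite hdotC xe rmorph0.
Qed.

Context (k : nat) (n : 'I_k -> nat) (F : forall i, fock_space R (n i)).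
Context (E : hilbert_tensor F).

Lemma nrm_tens x : nrm (tens E x) = \prod_i nrm (x i).
Proof.
apply/eqP; rewrite -(@eqrXn2 _ 2)//; first last.
- by apply: prodr_ge0 => i _; exact: nrm_ge0.
- exact: nrm_ge0.
apply/eqP/(@complexI R); rewrite -hdot_nrm hdot_tens -prodrXl rmorph_prod.
by apply: eq_bigr => i _; rewrite hdot_nrm.
Qed.

(** A vector orthogonal to the basis tensors is orthogonal to all elementary
    tensors: release the factors from the basis one at a time, using that a
    bounded functional on a factor is given by a vector. *)
Lemma tensor_basis_sep y : (forall b, hdot (tensor_basis E b) y = 0) -> y = 0.
Proof.
move=> yb; apply: (total_ortho (tens_total E)) => _ [x _ <-].
suff /(_ k x) : forall j (x : forall i, F i),
    (forall i : 'I_k, (j <= i)%N -> exists a, x i = fock_basis (F i) a) ->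
    hdot (tens E x) y = 0.
  by apply => i; rewrite leqNgt ltn_ord.
elim=> [|j IH] {}x xb.
  have [b bx] := fin_all_exists (fun i => xb i (leq0n i)).
  rewrite -(yb (finfun b)) /tensor_basis; congr (hdot (tens E _) y).
  by apply: functional_extensionality_dep => i; rewrite ffunE bx.
have [kj|jk] := leqP k j.
  by apply: IH => i ji; have := leq_trans (ltn_ord i) (leq_trans kj ji); rewrite ltnn.
pose i0 := Ordinal jk.
have [||v vP] := @riesz _ _ (fun z : F i0 => hdot (tens E (dfwith x i0 z)) y).
- by move=> a u v; rewrite tens_multilinear hdotDl hdotZl.
- exists ((\prod_(i | i != i0) nrm (x i)) * nrm y) => z.
  apply: le_trans (cabs_hdot _ _) _; rewrite mulrAC ler_wpM2r ?nrm_ge0//.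
  rewrite nrm_tens (bigD1 i0)//= dfwithin mulrC ler_wpM2r ?nrm_ge0//.
  rewrite le_eqVlt; apply/orP; left; apply/eqP; apply: eq_bigr => i ii0.
  by rewrite dfwithout// eq_sym.
have v0 : v = 0.
  have [_ sep] := fock_onb (F i0); apply: sep => a; rewrite hdotC -vP.
  rewrite IH ?rmorph0// => i ji.
  have [<-|ii0] := eqVneq i0 i; first by exists a; rewrite dfwithin.
  rewrite dfwithout//; apply: xb; rewrite ltn_neqAle ji andbT.
  by apply: contra ii0 => /eqP ij; apply/eqP/val_inj.
have := vP (x i0); rewrite v0 hdot0r => <-; congr (hdot (tens E _) y).
apply: functional_extensionality_dep => i.
have [<-|ii0] := eqVneq i0 i; first by rewrite dfwithin.
by rewrite dfwithout.
Qed.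

Lemma tensor_onb : complete_orthonormal (tensor_basis E).
Proof.
split=> [a b|x xb]; last by apply: tensor_basis_sep => b; rewrite hdotC xb rmorph0.
rewrite hdot_tens; have [<-|ab] := eqVneq a b.
  by rewrite big1// => i _; rewrite (onb_dot (fock_onb (F i))) eqxx.
have [i abi] : exists i, a i != b i.
  apply: contrapT => /forallNP nab; case/eqP: ab; apply: mwordP => i.
  by have /negP := nab i; rewrite negbK => /eqP.
by rewrite (bigD1 i)//= (onb_dot (fock_onb (F i))) (negbTE abi) mul0r.
Qed.

End TensorBasis.

(** * The universal shifts *)

Local Arguments bcoef : simpl never.

Section WeightedShift.
Context (R : realType) (l : nat) (q : ncpoly R l) (m : nat).
Hypotheses (q_reg : positive_regular q) (m_gt0 : (0 < m)%N).

Let q0 : q [::] = 0. Proof. by case: q_reg. Qed.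
Let q_ge0 a : 0 <= q a. Proof. by case: q_reg. Qed.
Let q1 j : 0 < q [:: j]. Proof. by case: q_reg. Qed.

Lemma bcoef_gt0 a : 0 < bcoef q m a.
Proof. by rewrite bcoefE// -(prednK m_gt0); apply: bser_gt0. Qed.

Lemma bcoef_ratio j a : 0 <= bcoef q m a / bcoef q m (j :: a) <= (q [:: j])^-1.
Proof.
apply/andP; split; first by rewrite divr_ge0// ltW// bcoef_gt0.
rewrite ler_pdivrMr ?bcoef_gt0// mulrC ler_pdivlMr//.
by rewrite mulrC !bcoefE// -(prednK m_gt0); exact: bser_cons_ge.
Qed.

Context (F : fock_space R l).
Let onbF := fock_onb F.

(** An operator with these coordinates exists because the weights are bounded; it
    has the prescribed values on the basis, and only one bounded operator does. *)
Lemma weighted_shiftP j : bounded_op (weighted_shift q m (F := F) j) /\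
  forall x a, hdot (weighted_shift q m j x) (fock_basis F a) =
    if a is j' :: a' then
      if j' == j then (Num.sqrt (bcoef q m a' / bcoef q m a))%:C *
        hdot x (fock_basis F a') else 0
    else 0.
Proof.
pose tau (a : seq 'I_l) :=
  if a is j' :: a' then if j' == j then Some a' else None else None.
pose w a := Num.sqrt (bcoef q m (behead a) / bcoef q m a).
have [|||A bA AP] := @weighted_shift_exists _ _ _ _ onbF tau w
    (Num.sqrt (q [:: j])^-1).
- move=> [|j1 u] [|j2 u'] t //=; case: eqP => // ->; case: eqP => // -> [->] [->].
  by [].
- exact: sqrtr_ge0.
- move=> [|j1 u] //=; case: eqP => // -> _.
  by rewrite ger0_norm ?sqrtr_ge0// ler_wsqrtr//; case/andP: (bcoef_ratio j u).
have Ae a : A (fock_basis F a) =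
    (Num.sqrt (bcoef q m a / bcoef q m (j :: a)))%:C *: fock_basis F (j :: a).
  apply: (onb_eq onbF) => u; rewrite AP hdotZl !(onb_dot onbF).
  case: u => [|j' u] /=; first by rewrite mulr0.
  rewrite eqseq_cons (eq_sym j); case: eqP => [->|_] /=; last by rewrite mulr0.
  rewrite (onb_dot onbF); case: eqVneq => [->//|_].
  by rewrite !mulr0.
suff -> : weighted_shift q m j = A.
  by split => // x [|j' a]; rewrite AP //=; case: eqP.
rewrite /weighted_shift; case: xgetP => [B _ [bB Be]|/(_ A)]; last by case.
have [_ tot] := fock_basisP F.
by apply: (bounded_eq_total tot bB bA) => _ [a _ <-]; rewrite Be Ae.
Qed.

End WeightedShift.

Section TensorShift.
Context (R : realType) (k : nat) (n m : 'I_k -> nat).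
Hypothesis m_gt0 : forall i, (0 < m i)%N.
Context (q : forall i, ncpoly R (n i)).
Hypothesis q_reg : forall i, positive_regular (q i).
Context (F : forall i, fock_space R (n i)) (E : hilbert_tensor F).

Notation W := (tensor_shift m q (E := E)).
Notation wt i a := (bcoef (q i) (m i) a).
Let onbE := tensor_onb E.

Lemma wt_gt0 i a : 0 < wt i a.
Proof. exact: bcoef_gt0. Qed.

Definition msqnorm (d : mword n) : R := \prod_i wt i (d i).

Lemma msqnorm_gt0 d : 0 < msqnorm d.
Proof. by apply: prodr_gt0 => i _; exact: wt_gt0. Qed.

Lemma msqnorm_upd d i w :
  msqnorm (upd d i w) = wt i w * \prod_(i' | i' != i) wt i' (d i').
Proof.
rewrite /msqnorm (bigD1 i)//= upd_in; congr (_ * _); apply: eq_bigr => i' ii'.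
by rewrite upd_out// eq_sym.
Qed.

Lemma msqnormD1 d i : msqnorm d = wt i (d i) * \prod_(i' | i' != i) wt i' (d i').
Proof. by rewrite -[in LHS](upd_id d i) msqnorm_upd. Qed.

Lemma msqnorm0 : msqnorm (mword0 n) = 1.
Proof. by rewrite /msqnorm big1// => i _; rewrite ffunE. Qed.

(** In the rescaled basis the weighted shifts move coordinates without any
    weight; the weights survive only in the norms of the basis vectors. *)
Definition hbasis (d : mword n) : E := (Num.sqrt (msqnorm d))%:C *: tensor_basis E d.

Let sqrtN0 d : (Num.sqrt (msqnorm d))%:C != 0 :> R[i].
Proof. by rewrite fmorph_eq0 gt_eqF// sqrtr_gt0 msqnorm_gt0. Qed.

Lemma hdot_hbasis x d :
  hdot x (hbasis d) = (Num.sqrt (msqnorm d))%:C * hdot x (tensor_basis E d).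
Proof. by rewrite hdotZr conjR. Qed.

Lemma hbasis_eq x y : (forall d, hdot x (hbasis d) = hdot y (hbasis d)) -> x = y.
Proof.
move=> xy; apply: (onb_eq onbE) => d.
by have := xy d; rewrite !hdot_hbasis => /(mulfI (sqrtN0 d)).
Qed.

Lemma hbasis_dot a b : hdot (hbasis a) (hbasis b) =
  if a == b then (msqnorm a)%:C else 0.
Proof.
rewrite hdot_hbasis hdotZl (onb_dot onbE); case: eqVneq => [->|_].
  by rewrite mulr1 -realCM -expr2 sqr_sqrtr// ltW// msqnorm_gt0.
by rewrite !mulr0.
Qed.

Lemma hbasis0 : hbasis (mword0 n) = vacuum E.
Proof.
rewrite /hbasis msqnorm0 sqrtr1 scale1r; congr (tens E _).
by apply: functional_extensionality_dep => i; rewrite ffunE.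
Qed.

Lemma hdot_multiplier x y d (c : R[i]) :
  hdot y (hbasis d) = c * hdot x (hbasis d) ->
  hdot y (tensor_basis E d) = c * hdot x (tensor_basis E d).
Proof. by rewrite !hdot_hbasis mulrCA => /(mulfI (sqrtN0 d)). Qed.

(** The operator is built on the basis tensors; that it acts on an arbitrary
    elementary tensor through the slot [i] only is read off the coordinates. *)
Lemma tensor_shift_spec i j : bounded_op (W i j) /\
  forall x d, hdot (W i j x) (tensor_basis E d) =
    if d i is j' :: a' then
      if j' == j then (Num.sqrt (wt i a' / wt i (d i)))%:C *
        hdot x (tensor_basis E (upd d i a')) else 0
    else 0.
Proof.
pose tau (d : mword n) :=
  if d i is j' :: a' then if j' == j then Some (upd d i a') else None else None.
pose w (d : mword n) := Num.sqrt (wt i (behead (d i)) / wt i (d i)).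
have [|||A bA AP] := @weighted_shift_exists _ _ _ _ onbE tau w
    (Num.sqrt (q i [:: j])^-1).
- rewrite /tau => u u' t; case uE: (u i) => [|j1 a]//; case: eqP => // j1j [tE].
  case uE': (u' i) => [|j2 a']//; case: eqP => // j2j [tE'].
  have aa : a = a' by rewrite -(upd_in u a) tE -tE' upd_in.
  rewrite -(upd_id u i) -(upd_id u' i) uE uE' j1j j2j -aa.
  by rewrite -(upd_upd u a) -(upd_upd u' a) tE aa tE'.
- exact: sqrtr_ge0.
- move=> u; rewrite /tau /w; case: (u i) => [|j1 a] //=; case: eqP => // -> _.
  rewrite ger0_norm ?sqrtr_ge0// ler_wsqrtr//.
  by case/andP: (bcoef_ratio (q_reg i) (m_gt0 i) j a).
have {}AP x d : hdot (A x) (tensor_basis E d) =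
    if d i is j' :: a' then
      if j' == j then (Num.sqrt (wt i a' / wt i (d i)))%:C *
        hdot x (tensor_basis E (upd d i a')) else 0
    else 0.
  by rewrite AP /tau /w; case: (d i) => [|j' a]//=; case: eqP.
have Atens x : A (tens E x) = tens E (dfwith x i (weighted_shift (q i) (m i) j (x i))).
  apply: (onb_eq onbE) => d; rewrite AP !hdot_tens [RHS](bigD1 i)//= dfwithin.
  have [_ ->] := weighted_shiftP (q_reg i) (m_gt0 i) (F i) j.
  case dE: (d i) => [|j' a]; first by rewrite mul0r.
  case: ifP => _; last by rewrite mul0r.
  rewrite -mulrA; congr (_ * _); rewrite hdot_tens (bigD1 i)//= upd_in; congr (_ * _).
  by apply: eq_bigr => i' ii'; rewrite upd_out 1?eq_sym// dfwithout// eq_sym.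
suff -> : W i j = A by [].
rewrite /tensor_shift; case: xgetP => [B _ [bB Be]|/(_ A)]; last by case.
apply: (bounded_eq_total (tens_total E) bB bA) => _ [x _ <-].
by rewrite Be Atens.
Qed.

Lemma tensor_shift_bounded i j : bounded_op (W i j).
Proof. by have [] := tensor_shift_spec j. Qed.

Lemma tensor_shift_hbasis i j x d : hdot (W i j x) (hbasis d) =
  if prefix [:: j] (d i) then hdot x (hbasis (upd d i (behead (d i)))) else 0.
Proof.
rewrite hdot_hbasis; have [_ ->] := tensor_shift_spec j.
case dE: (d i) => [|j' a] /=; first by rewrite mulr0.
rewrite eq_sym prefix0s andbT; case: eqVneq => [jj|_]; last by rewrite mulr0.
rewrite hdot_hbasis mulrA -realCM; congr ((_)%:C * _).
rewrite -sqrtrM ?ltW ?msqnorm_gt0//; congr Num.sqrt.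
rewrite (msqnormD1 d i) msqnorm_upd dE; field.
by rewrite gt_eqF// wt_gt0.
Qed.

Lemma wordop_hbasis i w x d : hdot (wordop (W i) w x) (hbasis d) =
  if prefix w (d i) then hdot x (hbasis (upd d i (drop (size w) (d i)))) else 0.
Proof.
elim: w d => [|j w IH] d; first by rewrite prefix0s drop0 upd_id.
rewrite wordop_cons [LHS]tensor_shift_hbasis.
case dE: (d i) => [|j' a]//=; rewrite prefix0s andbT.
case: eqP => //= _; rewrite IH upd_in.
by case: ifP => // _; rewrite upd_upd.
Qed.

Lemma mwordop_hbasis b x d : hdot (mwordop W b x) (hbasis d) =
  if mprefix b d then hdot x (hbasis (mdrop b d)) else 0.
Proof.
rewrite /mwordop.
have -> : mprefix b d = all (fun i => prefix (b i) (d i)) (enum 'I_k).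
  apply/forallP/allP => [bd i _|bd i]; first exact: bd.
  by apply: bd; rewrite mem_enum.
have -> : mdrop b d = finfun (fun i => if i \in enum 'I_k then
    drop (size (b i)) (d i) else d i).
  by apply: mwordP => i; rewrite !ffunE mem_enum.
elim: (enum _) (enum_uniq 'I_k) d => [_|i s IH /= /andP[si us]] d.
  by congr (hdot x (hbasis _)); apply: mwordP => i; rewrite ffunE.
rewrite [LHS]wordop_hbasis; case: ifP => //= _; rewrite {}IH//.
set d' := upd d i _.
have -> : all (fun i' => prefix (b i') (d' i')) s =
          all (fun i' => prefix (b i') (d i')) s.
  apply: eq_in_all => i' i's; rewrite upd_out//.
  by apply: contraNneq si => ->.
congr (if _ then hdot x (hbasis _) else _); apply: mwordP => i'; rewrite !ffunE inE.
have [->|ii'] := eqVneq i' i; first by rewrite (negbTE si) dfwithin.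
by rewrite dfwithout// eq_sym.
Qed.

Lemma mwordop_bounded b : bounded_op (mwordop W b).
Proof. by apply: bounded_mwordop => i j; exact: tensor_shift_bounded. Qed.

Lemma mwordop_hbasisE b a : mwordop W b (hbasis a) =
  (msqnorm a / msqnorm (mcat b a))%:C *: hbasis (mcat b a).
Proof.
apply: hbasis_eq => d; rewrite mwordop_hbasis [RHS]hdotZl !hbasis_dot.
have [<-|ad] := eqVneq (mcat b a) d.
  rewrite mprefix_cat mdrop_cat eqxx -realCM divfK//.
  by rewrite gt_eqF// msqnorm_gt0.
rewrite mulr0; case: ifPn => // bd; case: eqP => // aE; case/eqP: ad.
by rewrite aE mcat_drop.
Qed.

End TensorShift.

(** * Compressions to co-invariant subspaces *)

Section Coextension.
Context (R : realType) (k : nat) (n : 'I_k -> nat).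

Lemma PhiE (H : hilbertType R) l (q : ncpoly R l) (X : 'I_l -> H -> H) Y x :
  Phi q X Y x = \sum_(a <- finsupp q)
    (q a)%:C *: wordop X a (Y (adj (wordop X a) x)).
Proof. by rewrite /Phi fct_sumE. Qed.

Lemma linear_sub_fct (H : hilbertType R) (Y Z : H -> H) x : (Y - Z) x = Y x - Z x.
Proof. by []. Qed.

(** Both the inclusion of a co-invariant subspace and a unitary equivalence are
    isometries [V] of this kind. *)
Record coextension (H K : hilbertType R) (V : H -> K) (T : optuple n H)
    (X : optuple n K) : Prop := Coextension {
  coext_linear : linear V;
  coext_isometry : forall x y, hdot (V x) (V y) = hdot x y;
  coext_boundedl : forall i j, bounded_op (T i j);
  coext_boundedr : forall i j, bounded_op (X i j);
  coext_adj : forall i j x, adj (X i j) (V x) = V (adj (T i j) x) }.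

Context (H K : hilbertType R) (V : H -> K) (T : optuple n H) (X : optuple n K).
Arguments T : clear implicits.
Arguments X : clear implicits.
Hypothesis VTX : coextension V T X.

Lemma coext_wordop i w x : adj (wordop (X i) w) (V x) = V (adj (wordop (T i) w) x).
Proof.
have bT := coext_boundedl VTX; have bX := coext_boundedr VTX.
elim: w x => [|j w IH] x; first by rewrite /= !adj_id.
rewrite !wordop_cons (adj_comp (bX i j) (bounded_wordop w (bX i))).
rewrite (adj_comp (bT i j) (bounded_wordop w (bT i))).
by rewrite [LHS]/= (coext_adj VTX) IH.
Qed.

Lemma coext_mwordop b x : adj (mwordop X b) (V x) = V (adj (mwordop T b) x).
Proof.
have bT := coext_boundedl VTX; have bX := coext_boundedr VTX.
rewrite /mwordop; elim: (enum _) x => [|i s IH] x; first by rewrite /= !adj_id.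
have bs (L : hilbertType R) (Y : optuple n L) : (forall i j, bounded_op (Y i j)) ->
    bounded_op (opcomps [seq wordop (Y i) (b i) | i <- s]).
  move=> bY; elim: s {IH} => [|i' s IH]; first exact: bounded_idfun.
  exact: bounded_comp (bounded_wordop (b i') (bY i')) IH.
rewrite [opcomps _]/= (adj_comp (bounded_wordop (b i) (bX i)) (bs _ X bX)).
rewrite [in RHS]/= (adj_comp (bounded_wordop (b i) (bT i)) (bs _ T bT)).
by rewrite [LHS]/= coext_wordop IH.
Qed.

(** [Y = V^* Z V], tested weakly so that nothing has to be known about [Y] and [Z]. *)
Definition compression (Y : H -> H) (Z : K -> K) : Prop :=
  forall x y, hdot (Y x) y = hdot (Z (V x)) (V y).

Lemma compression_id : compression idfun idfun.
Proof. by move=> x y; rewrite (coext_isometry VTX). Qed.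

Lemma compressionB Y Z Y' Z' : compression Y Z -> compression Y' Z' ->
  compression (Y - Y') (Z - Z').
Proof. by move=> YZ YZ' x y; rewrite !linear_sub_fct !hdotBl YZ YZ'. Qed.

Lemma compression_mwordop b : compression (mwordop T b) (mwordop X b).
Proof.
have bT := coext_boundedl VTX; have bX := coext_boundedr VTX.
move=> x y; rewrite (adjP (bounded_mwordop b bT)) (adjP (bounded_mwordop b bX)).
by rewrite coext_mwordop (coext_isometry VTX).
Qed.

Lemma compression_Phi i (q : ncpoly R (n i)) Y Z : compression Y Z ->
  compression (Phi q (T i) Y) (Phi q (X i) Z).
Proof.
have bT := coext_boundedl VTX; have bX := coext_boundedr VTX.
move=> YZ x y; rewrite !PhiE !hdot_suml; apply: eq_bigr => w _.
rewrite !hdotZl (adjP (bounded_wordop w (bT i))) (adjP (bounded_wordop w (bX i))).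
by rewrite !coext_wordop YZ.
Qed.

Lemma compression_iter (L : (H -> H) -> H -> H) (L' : (K -> K) -> K -> K) Y Z p :
  (forall Y' Z', compression Y' Z' -> compression (L Y') (L' Z')) ->
  compression Y Z -> compression (iter p L Y) (iter p L' Z).
Proof. by move=> LL YZ; elim: p => //= p; exact: LL. Qed.

Context (q : forall i, ncpoly R (n i)).

Lemma compression_defect p Y Z : compression Y Z ->
  compression (defect q T p Y) (defect q X p Z).
Proof.
move=> YZ; rewrite /defect; elim: (enum _) => //= i s IH.
apply: compression_iter IH => Y' Z' YZ'.
by apply: compressionB => //; exact: compression_Phi.
Qed.

Lemma compression_pure_net s : compression (pure_net q T s) (pure_net q X s).
Proof.
rewrite /pure_net; elim: (enum _) (idfun : H -> H) (idfun : K -> K) compression_id.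
  by [].
move=> i t IH Y Z YZ /=; apply: IH; apply: compressionB => //.
by apply: compression_iter YZ => Y' Z'; exact: compression_Phi.
Qed.

End Coextension.

(** * Diagonal operators and the defects of the shifts *)

Section Symbols.
Context (R : realType) (k : nat) (n m : 'I_k -> nat).
Hypothesis m_gt0 : forall i, (0 < m i)%N.
Context (q : forall i, ncpoly R (n i)).
Hypothesis q_reg : forall i, positive_regular (q i).
Context (F : forall i, fock_space R (n i)) (E : hilbert_tensor F).

Notation W := (tensor_shift m q (E := E)).
Notation h := (hbasis m q E).
Notation wt := (fun i => bcoef (q i) (m i)).

Let q0 i : q i [::] = 0. Proof. by case: (q_reg i). Qed.
Let q_ge0 i a : 0 <= q i a. Proof. by case: (q_reg i). Qed.

Let family := forall i, seq 'I_(n i) -> R.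

(** A diagonal operator whose eigenvalues are a product over the slots. Taking out
    the weights turns the action of [Phi] on [f] into a convolution. *)
Definition has_symbol (f : family) (Y : E -> E) : Prop := forall x d,
  hdot (Y x) (h d) = (\prod_i (f i (d i) / wt i (d i)))%:C * hdot x (h d).

Lemma symbol_eq f f' Y : (forall i a, f i a = f' i a) ->
  has_symbol f Y -> has_symbol f' Y.
Proof.
by move=> ff Yf x d; rewrite Yf; congr (_%:C * _); apply: eq_bigr => i _; rewrite ff.
Qed.

Lemma symbol_id : has_symbol (fun i => wt i) idfun.
Proof.
move=> x d; rewrite big1 ?mul1r// => i _; rewrite divff//.
by rewrite gt_eqF// wt_gt0.
Qed.

Lemma symbolB i f g Y Z : has_symbol (dfwith f i g) Y ->
    forall g', has_symbol (dfwith f i g') Z ->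
  has_symbol (dfwith f i (fun a => g a - g' a)) (Y - Z).
Proof.
move=> Yf g' Zf x d; rewrite linear_sub_fct hdotBl Yf Zf -mulrBl -rmorphB.
congr (_%:C * _); rewrite !(bigD1 i (P := xpredT))//= !dfwithin mulrBl mulrBl.
by congr (_ * _ - _ * _); apply: eq_bigr => i' ii'; rewrite !dfwithout// eq_sym.
Qed.

Lemma wordop_hbasisE i (w : seq 'I_(n i)) (d : mword n) : prefix w (d i) ->
  wordop (W i) w (h (upd d i (drop (size w) (d i)))) =
  (wt i (drop (size w) (d i)) / wt i (d i))%:C *: h d.
Proof.
move=> wd; apply: (hbasis_eq m_gt0 q_reg) => c; rewrite (wordop_hbasis m_gt0 q_reg).
rewrite [RHS]hdotZl !(hbasis_dot m_gt0 q_reg).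
have [dc|dc] := eqVneq d c.
  rewrite -dc wd eqxx -realCM; congr (_%:C).
  rewrite msqnorm_upd (msqnormD1 m q d i); field.
  by rewrite gt_eqF// wt_gt0.
rewrite mulr0; case: ifP => // wc; case: eqP => // dcE; case/eqP: dc.
have restore (e : mword n) : prefix w (e i) -> upd (upd e i (drop (size w) (e i))) i
    (w ++ drop (size w) (e i)) = e.
  by move=> /prefixP[v ev]; rewrite upd_upd ev drop_size_cat// -ev upd_id.
have dd : drop (size w) (d i) = drop (size w) (c i).
  by rewrite -[LHS](upd_in d) dcE upd_in.
by rewrite -(restore d wd) dcE dd restore.
Qed.

(** A word [w] and its adjoint move the coordinate at [d] to the word without the
    prefix [w] and back; the squared weights of this round trip turn one weight
    into the other. *)
Lemma symbol_Phi i f Y : has_symbol f Y ->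
  has_symbol (dfwith f i (conv (q i) (f i))) (Phi (q i) (W i) Y).
Proof.
move=> Yf x d; rewrite PhiE hdot_suml.
rewrite (bigD1 i)//= dfwithin -sum_finsupp_conv !mulr_suml realC_sum mulr_suml.
apply: eq_bigr => w _; rewrite hdotZl (wordop_hbasis m_gt0 q_reg).
case: ifPn => wd; last by rewrite !(mulr0, mul0r).
rewrite Yf -adjPr; last first.
  by apply: bounded_wordop => j; exact: tensor_shift_bounded.
rewrite wordop_hbasisE// hdotZr conjR !mulrA -!realCM; congr (_%:C * _).
rewrite (bigD1 i)//= upd_in.
set P := \prod_(_ | _) _; set P' := \prod_(_ | _) _.
have -> : P = P'.
  by apply: eq_bigr => i' ii'; rewrite upd_out 1?eq_sym// dfwithout// eq_sym.
by field; rewrite !gt_eqF ?wt_gt0.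
Qed.

Lemma dfwith_id (f : family) i : dfwith f i (f i) = f.
Proof.
apply: functional_extensionality_dep => i'; have [<-|ii'] := eqVneq i i'.
  by rewrite dfwithin.
by rewrite dfwithout.
Qed.

Lemma dfwith_dfwith (f : family) i g g' : dfwith (dfwith f i g) i g' = dfwith f i g'.
Proof.
apply: functional_extensionality_dep => i'; have [<-|ii'] := eqVneq i i'.
  by rewrite !dfwithin.
by rewrite !dfwithout.
Qed.

(** [L] acts on diagonal operators through the slot [i]. *)
Definition acts_as i (L : (E -> E) -> E -> E)
    (g : (seq 'I_(n i) -> R) -> seq 'I_(n i) -> R) : Prop :=
  forall f Y, has_symbol f Y -> has_symbol (dfwith f i (g (f i))) (L Y).

Lemma acts_iter i L g p : @acts_as i L g -> acts_as (iter p L) (iter p g).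
Proof.
move=> Lg f Y Yf; elim: p => [|p IH] /=; first by rewrite dfwith_id.
by have := Lg _ _ IH; rewrite dfwith_dfwith dfwithin.
Qed.

Lemma acts_sub i L g : @acts_as i L g ->
  acts_as (fun Z => Z - L Z) (fun u a => u a - g u a).
Proof.
move=> Lg f Y Yf; apply: symbolB; last exact: Lg.
by rewrite dfwith_id.
Qed.

Lemma symbol_foldr (L : 'I_k -> (E -> E) -> E -> E)
    (g : forall i, (seq 'I_(n i) -> R) -> seq 'I_(n i) -> R) s f Y :
  (forall i, acts_as (L i) (@g i)) -> uniq s -> has_symbol f Y ->
  has_symbol (fun i => if i \in s then @g i (f i) else f i) (foldr L Y s).
Proof.
move=> Lg + Yf; elim: s => [|i s IH] //= /andP[si /IH/(Lg i)].
apply: symbol_eq => i'; rewrite inE; have [-> a|ii' a] := eqVneq i' i.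
  by rewrite dfwithin (negbTE si).
by rewrite dfwithout// eq_sym.
Qed.

Lemma acts_Phi i : acts_as (Phi (q i) (W i)) (conv (q i)).
Proof. by move=> f Y; exact: symbol_Phi. Qed.

(** Each factor [id - Phi] lowers the exponent in [1 / (1 - q)^m] by one. *)
Lemma symbol_defect p : (forall i, p i <= m i)%N ->
  has_symbol (fun i => bser (q i) (m i - p i)) (defect q W p idfun).
Proof.
move=> pm; have := @symbol_foldr _ _ (enum 'I_k) _ _
  (fun i => acts_iter (p i) (acts_sub (@acts_Phi i))) (enum_uniq _) symbol_id.
apply: symbol_eq => i a; rewrite mem_enum /=.
elim: (p i) (pm i) a => [|r IH] rm a /=.
  by rewrite subn0 bcoefE.
rewrite -(@bser_rec _ _ (q i) (m i - r.+1) a)// subnSK//.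
by rewrite (funext (IH (ltnW rm))).
Qed.

Lemma symbol_pure_net s : has_symbol
  (fun i a => wt i a - iter (s i) (conv (q i)) (wt i) a) (pure_net q W s).
Proof.
rewrite /pure_net -(revK (enum 'I_k)) foldl_rev.
have us : uniq (rev (enum 'I_k)) by rewrite rev_uniq enum_uniq.
have := @symbol_foldr _ _ _ _ _
  (fun i => acts_sub (acts_iter (s i) (@acts_Phi i))) us symbol_id.
by apply: symbol_eq => i a; rewrite mem_rev mem_enum.
Qed.

Lemma has_symbol_onb f Y x d : has_symbol f Y ->
  hdot (Y x) (tensor_basis E d) =
  (\prod_i (f i (d i) / wt i (d i)))%:C * hdot x (tensor_basis E d).
Proof. by move=> Yf; apply: (hdot_multiplier m_gt0 q_reg); exact: Yf. Qed.

Lemma defect_shift_ge0 p : (forall i, p i <= m i)%N ->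
  positive_op (defect q W p idfun).
Proof.
move=> pm x; apply: (diag_ge0 (tensor_onb E)) => [|d]; last first.
  exact: has_symbol_onb (symbol_defect pm).
move=> d; apply: prodr_ge0 => i _.
by rewrite divr_ge0 ?bser_ge0// ltW// wt_gt0.
Qed.

(** For [p = m] only the unit of the convolution is left. *)
Lemma defect_shift x : defect q W m idfun x = hdot x (vacuum E) *: vacuum E.
Proof.
apply: (hbasis_eq m_gt0 q_reg) => d; rewrite symbol_defect// -(hbasis0 m q).
rewrite [RHS]hdotZl (hbasis_dot m_gt0 q_reg) msqnorm0.
have [<-|d0] := eqVneq (mword0 n) d.
  rewrite mulr1 big1 ?mul1r// => i _.
  by rewrite ffunE subnn bser0 eqxx /bcoef divr1.
have [i di] : exists i, d i != [::].
  apply: contrapT => /forallNP nd; case/eqP: d0; apply: mwordP => i.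
  by have /negP := nd i; rewrite ffunE negbK => /eqP.
by rewrite (bigD1 i)//= subnn bser0 (negbTE di) !mul0r mulr0.
Qed.

Global Instance product_net_filter : Filter (@product_net k).
Proof.
apply: filter_from_filter => [|s t _ _]; first by exists (fun=> 0%N).
exists (fun i => maxn (s i) (t i)) => // u su.
by split=> i; apply: leq_trans (su i); rewrite ?leq_maxl ?leq_maxr.
Qed.

(** The eigenvalue at [d] equals [1] once each exponent exceeds the length of [d],
    as [q] has no constant term. *)
Lemma pure_net_cvg x : pure_net q W s x @[s --> @product_net k] --> x.
Proof.
have wt_iter i s a : 0 <= iter s (conv (q i)) (wt i) a <= wt i a.
  have -> : wt i = bser (q i) (m i).-1.+1.
    by apply/funext => b; rewrite bcoefE// (prednK (m_gt0 i)).
  exact: iter_conv_bser.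
apply: (@multiplier_cvg _ _ _ _ (tensor_onb E) _ _ _ _ _ (fun s d => \prod_i
   ((wt i (d i) - iter (s i) (conv (q i)) (wt i) (d i)) / wt i (d i)))).
- by apply: filterE => s d; exact: has_symbol_onb (symbol_pure_net s).
- apply: filterE => s d; apply/andP; split.
    apply: prodr_ge0 => i _; rewrite divr_ge0// ?subr_ge0.
      by case/andP: (wt_iter i (s i) (d i)).
    by rewrite ltW// wt_gt0.
  apply: prodr_ile1 => i _; rewrite divr_ge0 ?subr_ge0/=; last 2 first.
  + by case/andP: (wt_iter i (s i) (d i)).
  + by rewrite ltW// wt_gt0.
  rewrite ler_pdivrMr ?wt_gt0// mul1r lerBlDr lerDl.
  by case/andP: (wt_iter i (s i) (d i)).
move=> d r r0; exists (fun i => (size (d i)).+1) => // s ds.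
rewrite big1 ?lerBlDr ?lerDl ?ltW// => i _.
by rewrite (iter_conv_eq0 _ (q0 i) (ds i)) subr0 divff// gt_eqF// wt_gt0.
Qed.

End Symbols.

(** * Limits of vectors and operators *)

Section Limits.
Context (R : realType).

Lemma hdot_cvg (H : hilbertType R) I (F : set_system I) (FF : Filter F)
    (u : I -> H) u0 x : u @ F --> u0 ->
  (hdot (u s) x : R[i]^o) @[s --> F] --> (hdot u0 x : R[i]^o).
Proof.
move=> /nrm_cvgP uu0; apply/(@nrm_cvgP _ R[i]^o) => e e0.
have x0 : 0 < nrm x + 1 by rewrite ltr_wpDl// nrm_ge0.
apply: filterS (uu0 _ (divr_gt0 e0 x0)) => s us.
rewrite -hdotBl; apply: le_lt_trans (cabs_hdot _ _) _.
have {}us : nrm (u0 - u s) * (nrm x + 1) < e by rewrite -ltr_pdivlMr.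
by apply: le_lt_trans us; rewrite ler_wpM2l ?nrm_ge0// lerDl.
Qed.

Lemma hdot_lim (H K : hilbertType R) I (F : set_system I) (FF : ProperFilter F)
    (u : I -> H) (v : I -> K) u0 v0 x y :
  u @ F --> u0 -> v @ F --> v0 ->
  (\forall s \near F, hdot (u s) x = hdot (v s) y) -> hdot u0 x = hdot v0 y.
Proof.
move=> /hdot_cvg-/(_ x) uu0 /hdot_cvg-/(_ y) vv0 uv.
apply: (cvg_unique (@norm_hausdorff _ R[i]^o) uu0).
apply: cvg_trans vv0; apply: near_eq_cvg.
by apply: filterS uv => s ->.
Qed.

Lemma lim_eq (H : hilbertType R) I (F : set_system I) (FF : ProperFilter F)
    (u : I -> H) (x y : H) : u @ F --> x -> u @ F --> y -> x = y.
Proof. by move=> ux uy; exact: (cvg_unique (@norm_hausdorff _ H) ux uy). Qed.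

Lemma nrm_lim_le (H : hilbertType R) I (F : set_system I) (FF : ProperFilter F)
    (u : I -> H) (x : H) (c : R) : u @ F --> x ->
  (\forall s \near F, nrm (u s) <= c) -> nrm x <= c.
Proof.
move=> /nrm_cvgP ux uc; apply/ler_addgt0Pr => e e0.
have /filter_ex[s [xs us]] : F ([set s | nrm (x - u s) < e] `&` [set s | nrm (u s) <= c]).
  exact: filterI (ux e e0) uc.
rewrite -(subrK (u s) x); apply: le_trans (nrmD _ _) _.
by rewrite addrC lerD//; exact: ltW.
Qed.

Lemma sum_cvg (H : hilbertType R) I (F : set_system I) (FF : Filter F) (T : Type)
    (s : seq T) (f : T -> I -> H) (l : T -> H) : (forall t, f t @ F --> l t) ->
  (fun i => \sum_(t <- s) f t i) @ F --> \sum_(t <- s) l t.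
Proof.
move=> fl; elim: s => [|t s IH].
  have -> : (fun i => \sum_(t <- [::]) f t i) = cst 0.
    by apply/funext => i; rewrite big_nil.
  by rewrite big_nil; exact: cvg_cst.
have -> : (fun i => \sum_(u <- t :: s) f u i) = (fun i => f t i + \sum_(u <- s) f u i).
  by apply/funext => i; rewrite big_cons.
by rewrite big_cons; apply: cvgD.
Qed.

Lemma sum_geometric (r : R) (N M : nat) : (N <= M)%N ->
  (1 - r) * (\sum_(N <= s < M) r ^+ s) = r ^+ N - r ^+ M.
Proof.
move=> NM; rewrite mulr_sumr -[RHS]opprB -(telescope_sumr _ NM) -sumrN.
by apply: eq_bigr => s _; rewrite opprB mulrBl mul1r exprS.
Qed.

(** The series converges in operator norm: the estimate is uniform in [x]. *)
Lemma power_series_op (H : hilbertType R) (D : nat -> H -> H) (C r : R) :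
    (forall s, linear (D s)) -> (forall s x, nrm (D s x) <= C * nrm x) ->
    0 <= C -> 0 <= r < 1 ->
  exists2 G : H -> H, bounded_op G & forall N x,
    nrm (\sum_(0 <= s < N) (r ^+ s)%:C *: D s x - G x) <= r ^+ N * (C / (1 - r)) * nrm x.
Proof.
move=> linD DC C0 /andP[r0 r1].
pose S x N := \sum_(0 <= s < N) (r ^+ s)%:C *: D s x.
have r1' : 0 < 1 - r by rewrite subr_gt0.
have SB x N M : (N <= M)%N -> nrm (S x M - S x N) <= r ^+ N * (C / (1 - r)) * nrm x.
  move=> NM; rewrite /S (big_cat_nat (n := N))//= addrAC subrr add0r.
  apply: le_trans (nrm_sum _ _ _) _.
  apply: (@le_trans _ _ (\sum_(N <= s < M) r ^+ s * (C * nrm x))).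
    apply: ler_sum => s _; rewrite nrmZ cabsR ger0_norm ?exprn_ge0//.
    by rewrite ler_wpM2l ?exprn_ge0.
  rewrite -mulr_suml -!mulrA [_ * (_ * nrm x)]mulrCA [leRHS]mulrCA.
  rewrite ler_wpM2l// mulrA ler_wpM2r ?nrm_ge0// ler_pdivlMr//.
  by rewrite mulrC sum_geometric// lerBlDr lerDl exprn_ge0.
have lim x : exists y : H, S x N @[N --> \oo] --> y.
  suff /cauchy_cvg/cvg_ex[y Sy] : cauchy (S x N @[N --> \oo]) by exists y.
  apply/cauchyP => e e0.
  have eE : e = (complex.Re e)%:C by rewrite RRe_real// gtr0_real.
  have {}e0 : 0 < complex.Re e by rewrite -ltcR -eE.
  have rN : r ^+ N * (C / (1 - r) * nrm x) @[N --> \oo] --> (0 : R).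
    rewrite -[X in _ --> X](mul0r (C / (1 - r) * nrm x)).
    by apply: cvgM; [apply: cvg_expr; rewrite ger0_norm|exact: cvg_cst].
  move/cvgrPdist_lt : rN => /(_ _ e0)[N _ rN].
  exists (S x N); exists N => // M NM; rewrite /= -ball_normE /ball_ /= nrmE eE ltcR.
  rewrite nrmB; apply: le_lt_trans (SB _ _ _ NM) _.
  rewrite -[ltLHS]mulrA; have := rN N (leqnn N); rewrite /= sub0r normrN.
  by apply: le_lt_trans; exact: ler_norm.
have [G SG] := choice lim.
have GB N x : nrm (S x N - G x) <= r ^+ N * (C / (1 - r)) * nrm x.
  apply: (@nrm_lim_le _ _ \oo _ (fun M => S x N - S x M)); last first.
    by exists N => // M NM; rewrite nrmB; exact: SB.
  by apply: cvgB; [exact: cvg_cst|exact: SG].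
exists G => //; apply/bounded_opP; split.
  move=> a x y; apply: (lim_eq _ (SG _)).
  have -> : S (a *: x + y) = (fun N => a *: S x N + S y N).
    apply/funext => N; rewrite /S scaler_sumr -big_split; apply: eq_bigr => s _ /=.
    by rewrite linD scalerDr !scalerA mulrC.
  by apply: cvgD; [apply: cvgZl_tmp|]; exact: SG.
exists (C / (1 - r)) => [|x]; first by rewrite divr_ge0// ltW.
by have := GB 0%N x; rewrite /S big_geq// sub0r nrmN expr0 mul1r.
Qed.

Lemma sum_CauchySchwarz (L : nat) (a b : nat -> R) (X Y : R) :
  0 <= X -> 0 <= Y -> (forall l, 0 <= a l) -> (forall l, 0 <= b l) ->
  \sum_(l < L) a l ^+ 2 <= X ^+ 2 -> \sum_(l < L) b l ^+ 2 <= Y ^+ 2 ->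
  \sum_(l < L) a l * b l <= X * Y.
Proof.
move=> X0 Y0 a0 b0 aX bY.
have zero (c : nat -> R) (Z : R) : (forall l, 0 <= c l) -> Z = 0 ->
    \sum_(l < L) c l ^+ 2 <= Z ^+ 2 -> forall l : 'I_L, c l = 0.
  move=> c0 -> cZ l; apply/eqP; rewrite -sqrf_eq0 eq_le sqr_ge0 andbT.
  rewrite expr0n in cZ; apply: le_trans cZ; rewrite (bigD1 l)//= lerDl.
  by apply: sumr_ge0 => l' _; exact: sqr_ge0.
have [Xz|Xz] := eqVneq X 0.
  by rewrite big1 ?mulr_ge0// => l _; rewrite (zero a X) ?mul0r.
have [Yz|Yz] := eqVneq Y 0.
  by rewrite big1 ?mulr_ge0// => l _; rewrite (zero b Y) ?mulr0.
have Xp : 0 < X by rewrite lt_neqAle eq_sym Xz.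
have Yp : 0 < Y by rewrite lt_neqAle eq_sym Yz.
have XYp : 0 < X * Y by rewrite mulr_gt0.
rewrite -(@ler_pM2l _ (X * Y *+ 2)) ?mulrn_wgt0//.
apply: (@le_trans _ _ (Y ^+ 2 * \sum_(l < L) a l ^+ 2 + X ^+ 2 * \sum_(l < L) b l ^+ 2)).
  rewrite !mulr_sumr -big_split /=; apply: ler_sum => l _.
  by have := sqr_ge0 (Y * a l - X * b l); lra.
have := ler_wpM2l (sqr_ge0 Y) aX; have := ler_wpM2l (sqr_ge0 X) bY.
lra.
Qed.

End Limits.

(** * Schur multipliers *)

Section Schur.
Context (R : realType) (H : hilbertType R) (T : choiceType) (e : T -> H).
Hypothesis e_onb : complete_orthonormal e.
Context (g G : H -> H) (C : R).
Hypotheses (g_linear : linear g) (G_bounded : bounded_op G) (C_ge0 : 0 <= C).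
Hypothesis g_le : forall x, nrm (g x) <= C * nrm x.

Let gG_finite (A : {fset T}) := forall x y,
  cabs (hdot (G (fcomb e x A)) (fcomb e y A)) <=
    C * (nrm (fcomb e x A) * nrm (fcomb e y A)).

Lemma hdot_fcomb2 (D : H -> H) x y A : linear D ->
  hdot (D (fcomb e x A)) (fcomb e y A) =
  \sum_(a <- A) \sum_(d <- A) x a * Num.conj (y d) * hdot (D (e a)) (e d).
Proof.
move=> linD; rewrite /fcomb (lin_sum linD) hdot_suml; apply: eq_bigr => a _.
rewrite (linZ linD) hdotZl hdot_sumr mulr_sumr; apply: eq_bigr => d _.
by rewrite hdotZr mulrA.
Qed.

(** A kernel [sum_l u a l * v d l] with rows of norm at most one is a sum of
    the bilinear forms obtained by rescaling the coordinates of both vectors. *)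
Lemma schur_finite (A : {fset T}) (L : nat) (u v : T -> nat -> R) :
    (forall a d, a \in A -> d \in A -> hdot (G (e a)) (e d) =
      (\sum_(l < L) u a l * v d l)%:C * hdot (g (e a)) (e d)) ->
    (forall a, a \in A -> \sum_(l < L) u a l ^+ 2 <= 1) ->
    (forall a, a \in A -> \sum_(l < L) v a l ^+ 2 <= 1) ->
  gG_finite A.
Proof.
move=> GE u1 v1 x y.
pose xl l := fcomb e (fun a => (u a l)%:C * x a) A.
pose yl l := fcomb e (fun a => (v a l)%:C * y a) A.
have -> : hdot (G (fcomb e x A)) (fcomb e y A) = \sum_(l < L) hdot (g (xl l)) (yl l).
  rewrite (hdot_fcomb2 _ _ _ (bounded_lin G_bounded)).
  under [RHS]eq_bigr do rewrite (hdot_fcomb2 _ _ _ g_linear).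
  rewrite [RHS]exchange_big big_seq [RHS]big_seq /=; apply: eq_bigr => a aA.
  rewrite [RHS]exchange_big big_seq [RHS]big_seq /=; apply: eq_bigr => d dA.
  rewrite GE// realC_sum mulr_suml mulr_sumr; apply: eq_bigr => l _.
  by rewrite realCM (mulrC (v d l)%:C (y d)) conjMR; ring.
have fin_le (w : T -> nat -> R) z : (forall a, a \in A -> \sum_(l < L) w a l ^+ 2 <= 1) ->
    \sum_(l < L) nrm (fcomb e (fun a => (w a l)%:C * z a) A) ^+ 2 <=
    nrm (fcomb e z A) ^+ 2.
  move=> w1; under eq_bigr do rewrite (nrm_fcomb e_onb).
  rewrite (nrm_fcomb e_onb) exchange_big big_seq [leRHS]big_seq /=.
  apply: ler_sum => a aA.
  under eq_bigr do rewrite cabsM cabsR exprMn real_normK ?num_real//.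
  by rewrite -mulr_suml ler_piMl ?sqr_ge0// w1.
apply: le_trans (nrm_sum _ _ _) _.
apply: (@le_trans _ _ (\sum_(l < L) C * (nrm (xl l) * nrm (yl l)))).
  apply: ler_sum => l _; apply: le_trans (cabs_hdot _ _) _.
  by rewrite mulrA ler_wpM2r// nrm_ge0.
rewrite -mulr_sumr ler_wpM2l//.
apply: (@sum_CauchySchwarz _ L (fun l => nrm (xl l)) (fun l => nrm (yl l)));
  rewrite ?nrm_ge0// => *; rewrite ?nrm_ge0//; exact: fin_le.
Qed.

Lemma schur_bound : (forall A, gG_finite A) -> forall x, nrm (G x) <= C * nrm x.
Proof.
move=> fin x; apply: nrm_hdot => [|y]; first by rewrite mulr_ge0 ?nrm_ge0.
have /bounded_opP[linG [K K0 GK]] := G_bounded.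
have cx := @onb_expansion _ _ _ _ e_onb x; have cy := @onb_expansion _ _ _ _ e_onb y.
apply/ler_addgt0Pr => r r0.
pose d := r / (K * nrm x + K * nrm y + 1).
have den : 0 < K * nrm x + K * nrm y + 1.
  by rewrite ltr_wpDl// addr_ge0// mulr_ge0// nrm_ge0.
have d0 : 0 < d by rewrite divr_gt0.
move/nrm_cvgP : cx => /(_ d d0) cx; move/nrm_cvgP : cy => /(_ d d0) cy.
have /filter_ex[B [xB yB]] : fset_filter T
    ([set B | nrm (x - fcomb e (coords e x) B) < d] `&`
     [set B | nrm (y - fcomb e (coords e y) B) < d]) by exact: filterI.
rewrite /= in xB yB.
set x' := fcomb e (coords e x) B in xB *; set y' := fcomb e (coords e y) B in yB *.
have -> : hdot (G x) y = hdot (G (x - x')) y + hdot (G x') (y - y') + hdot (G x') y'.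
  by rewrite (linB linG) hdotBl hdotBr; ring.
have xx : nrm x' <= nrm x by exact: bessel.
have yy : nrm y' <= nrm y by exact: bessel.
have t1 : cabs (hdot (G (x - x')) y) <= K * d * nrm y.
  apply: le_trans (cabs_hdot _ _) _; rewrite ler_wpM2r ?nrm_ge0//.
  by apply: le_trans (GK _) _; rewrite ler_wpM2l// ltW.
have t2 : cabs (hdot (G x') (y - y')) <= K * nrm x * d.
  apply: le_trans (cabs_hdot _ _) _; apply: ler_pM; rewrite ?nrm_ge0//; last exact: ltW.
  by apply: le_trans (GK _) _; rewrite ler_wpM2l.
have t3 : cabs (hdot (G x') y') <= C * nrm x * nrm y.
  apply: le_trans (fin _ _ _) _; rewrite -mulrA ler_wpM2l//.
  by apply: ler_pM; rewrite ?nrm_ge0.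
have dr : d * (K * nrm x + K * nrm y + 1) = r by rewrite divfK// gt_eqF.
apply: le_trans (nrmD _ _) _; rewrite -/(cabs _).
have := nrmD (hdot (G (x - x')) y : R[i]^o) (hdot (G x') (y - y')).
rewrite -!/(cabs _).
lra.
Qed.

End Schur.

(** Rows of a Gram matrix for the kernel [r ^+ |p - q|]: the stationary
    autoregression [v p.+1 = r v p + sqrt (1 - r^2) eps p.+1] with independent
    innovations. *)
Section AbelKernel.
Context (R : realType) (r : R).
Hypothesis r01 : 0 <= r < 1.

Fixpoint abel_row (p : nat) : nat -> R :=
  if p is p'.+1 then
    fun l => r * abel_row p' l + (if l == p then Num.sqrt (1 - r ^+ 2) else 0)
  else fun l => (l == 0%N)%:R.

Lemma abel_row_eq0 p l : (p < l)%N -> abel_row p l = 0.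
Proof.
elim: p => [|p IH] pl /=; first by rewrite gtn_eqF.
by rewrite IH ?(ltnW pl)// mulr0 add0r gtn_eqF.
Qed.

Lemma sum_pick (L p : nat) (f : nat -> R) (c : R) : (p < L)%N ->
  \sum_(l < L) f l * (if l == p :> nat then c else 0) = f p * c.
Proof.
move=> pL; rewrite (bigD1 (Ordinal pL))//= eqxx big1 ?addr0// => l lp.
by rewrite -[X in X == p]/(val l) -[p]/(val (Ordinal pL)) (inj_eq val_inj) (negbTE lp) mulr0.
Qed.

Lemma abel_row_dot L p t : (p + t < L)%N ->
  \sum_(l < L) abel_row p l * abel_row (p + t) l = r ^+ t.
Proof.
have s2 : Num.sqrt (1 - r ^+ 2) ^+ 2 = 1 - r ^+ 2.
  by rewrite sqr_sqrtr// subr_ge0 exprn_ile1//; case/andP: r01 => // _ /ltW.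
elim: t => [|t IH] ptL.
  rewrite addn0 expr0; elim: p ptL => [|p IHp] pL.
    rewrite (eq_bigr (fun l : 'I_L => 1 * (if l == 0%N :> nat then 1 else 0))).
      by rewrite (sum_pick (fun=> 1))// mulr1.
    by move=> l _ /=; case: eqP; rewrite ?mulr1 ?mulr0.
  have {}IHp := IHp (ltnW pL).
  rewrite (eq_bigr (fun l : 'I_L => r ^+ 2 * (abel_row p l * abel_row p l)
      + (r * abel_row p l *+ 2) * (if l == p.+1 :> nat then Num.sqrt (1 - r ^+ 2) else 0)
      + 1 * (if l == p.+1 :> nat then Num.sqrt (1 - r ^+ 2) ^+ 2 else 0))); last first.
    by move=> l _ /=; case: eqP => _; ring.
  rewrite !big_split /= -mulr_sumr IHp (sum_pick (fun l => r * abel_row p l *+ 2)).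
    rewrite (sum_pick (fun=> 1)); last by rewrite -[p.+1]addn0.
    by rewrite abel_row_eq0// s2; ring.
  by rewrite -[p.+1]addn0.
rewrite addnS in ptL *.
rewrite (eq_bigr (fun l : 'I_L => r * (abel_row p l * abel_row (p + t) l)
   + abel_row p l * (if l == (p + t).+1 :> nat then Num.sqrt (1 - r ^+ 2) else 0))); last first.
  by move=> l _ /=; ring.
rewrite big_split /= -mulr_sumr IH ?(ltnW ptL)// sum_pick//.
by rewrite abel_row_eq0 ?ltnS ?leq_addr// mul0r addr0 exprS.
Qed.

Lemma abel_row_norm L p : (p < L)%N -> \sum_(l < L) abel_row p l ^+ 2 = 1.
Proof.
move=> pL; rewrite -(expr0 r) -(@abel_row_dot L p 0) addn0//.
Qed.

End AbelKernel.

(** * The functional calculus *)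

Lemma finite_mlength k (n : 'I_k -> nat) s :
  finite_set [set b : mword n | mlength b = s].
Proof.
pose f (g : {dffun forall i : 'I_k, {bseq s of 'I_(n i)}}) : mword n :=
  finfun (fun i => val (g i)).
apply: (@sub_finite_set _ _ [set f g | g in setT]); last first.
  exact: finite_image finite_finset.
move=> b /= bs.
have sb i : (size (b i) <= s)%N.
  by rewrite -bs /mlength (bigD1 i)//= leq_addr.
exists (finfun (fun i => Bseq (sb i))) => //.
by apply: mwordP => i; rewrite !ffunE.
Qed.

Section Toeplitz.
Context (R : realType) (k : nat) (n m : 'I_k -> nat).
Hypothesis m_gt0 : forall i, (0 < m i)%N.
Context (q : forall i, ncpoly R (n i)).
Hypothesis q_reg : forall i, positive_regular (q i).
Context (F : forall i, fock_space R (n i)) (E : hilbert_tensor F).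

Notation W := (tensor_shift m q (E := E)).
Notation h := (hbasis m q E).
Notation h0 := (hbasis m q E (mword0 n)).
Notation N := (msqnorm m q).

(** The matrix of a power series in the shifts, in the basis where they carry no
    weight: entries depend only on the word that is added on the left. *)
Definition toeplitz (A : E -> E) : Prop :=
  (forall a b, hdot (A (h a)) (h (mcat b a)) = (N a)%:C * hdot (A h0) (h b)) /\
  (forall a d, (forall b, d <> mcat b a) -> hdot (A (h a)) (h d) = 0).

Lemma toeplitz_id : toeplitz idfun.
Proof.
split=> [a b|a d da]; rewrite !(hbasis_dot m_gt0 q_reg).
  rewrite msqnorm0; have [<-|b0] := eqVneq (mword0 n) b.
    rewrite mulr1 (_ : mcat _ a = a) ?eqxx//.
    by apply: mwordP => i; rewrite !ffunE.
  rewrite mulr0; case: eqP => // aE; case/eqP: b0.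
  apply: (@mcat_injl _ _ _ _ a); rewrite -aE.
  by apply: mwordP => i; rewrite !ffunE.
case: eqP => // ad; case: (da (mword0 n)).
by rewrite -ad; apply: mwordP => i; rewrite !ffunE.
Qed.

Lemma toeplitz_comb (a : R[i]) A A' : toeplitz A -> toeplitz A' ->
  toeplitz (a *: A + A').
Proof.
move=> [A1 A2] [A1' A2']; split=> [c b|c d cd]; rewrite !fctE !hdotDl !hdotZl.
  by rewrite A1 A1' mulrDr mulrCA.
by rewrite A2// A2'// mulr0 addr0.
Qed.

Lemma toeplitz_shift i j A : toeplitz A -> toeplitz (W i j \o A).
Proof.
move=> [A1 A2]; split=> [a b|a d da] /=; rewrite !(tensor_shift_hbasis m_gt0 q_reg).
  have catE : mcat b a i = b i ++ a i by rewrite ffunE.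
  rewrite catE; case bE: (b i) => [|j' v] /=.
    rewrite mulr0; case aE: (a i) => [|j' v] //=; case: ifP => // _.
    apply: A2 => c /(congr1 (fun e : mword n => size (e i))).
    rewrite upd_in ffunE aE size_cat /= => /eqP.
    by rewrite addnS ltn_eqF// ltnS leq_addl.
  rewrite !prefix0s; case: ifP => _; last by rewrite mulr0.
  rewrite -A1; congr (hdot _ (h _)); apply: mwordP => i'.
  rewrite [RHS]ffunE; have [<-|ii'] := eqVneq i i'; first by rewrite !upd_in.
  by rewrite !upd_out// ffunE.
case: ifP => // jd; apply: A2 => c cE; apply: (da (upd c i (j :: c i))).
have dE : d i = j :: behead (d i).
  by case: (d i) jd => //= j' v; rewrite prefix0s andbT => /eqP ->.
rewrite -(upd_id d i) dE; apply: mwordP => i'; rewrite [RHS]ffunE.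
have := congr1 (fun e : mword n => e i') cE.
have [<-|ii'] := eqVneq i i'; first by rewrite !upd_in ffunE => ->.
by rewrite !upd_out// ffunE.
Qed.

(** Multiplying on the left by a polynomial in the shifts preserves the Toeplitz
    form; unlike the Toeplitz form itself, this is visibly stable under products. *)
Lemma toeplitz_polynomial p : op_polynomials m q (E := E) p ->
  bounded_op p /\ toeplitz p.
Proof.
pose B := [set A : E -> E | bounded_op A /\ forall A', toeplitz A' -> toeplitz (A \o A')].
move=> /(_ B)[|bp pT]; last by split=> //; exact: (pT _ toeplitz_id).
split; last first.
  move=> _ [i [j ->]]; split; first exact: tensor_shift_bounded.
  by move=> A'; exact: toeplitz_shift.
split=> [|a A A' [bA tA] [bA' tA']|A A' [bA tA] [bA' tA']].
- by split=> //; exact: bounded_idfun.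
- split=> [|A'' tA'']; first exact: bounded_comb.
  exact: (toeplitz_comb a (tA _ tA'') (tA' _ tA'')).
- split=> [|A'' tA'']; first exact: bounded_comp.
  exact: (tA _ (tA' _ tA'')).
Qed.

(** Matrix entries pass to strong limits. *)
Lemma toeplitz_hardy g : hardy_algebra m q (E := E) g -> toeplitz g.
Proof.
move=> [_ [p pP pg]]; split=> [a b|a d ad].
  have -> : (N a)%:C * hdot (g h0) (h b) = hdot (g h0) ((N a)%:C *: h b).
    by rewrite [RHS]hdotZr conjR.
  apply: (hdot_lim _ (pg _) (pg _)); apply: nearW => l.
  have [_ [p1 _]] := toeplitz_polynomial (pP l).
  by rewrite [RHS]hdotZr conjR.
have <- : hdot (0 : E) (h d) = 0 by rewrite hdot0l.
have cvg0 : (fun=> 0 : E) @ \oo --> (0 : E) by exact: cvg_cst.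
apply: (hdot_lim _ (pg _) cvg0); apply: nearW => l.
have [_ [_ p2]] := toeplitz_polynomial (pP l).
by rewrite p2// hdot0l.
Qed.

Context (g : E -> E).
Hypotheses (g_bounded : bounded_op g) (g_toeplitz : toeplitz g).

Definition fourier_coef (b : mword n) : R[i] := hdot (g h0) (h b).
Notation c := fourier_coef.

Lemma hdot_mword_sum (B : {fset mword n}) a d :
  hdot (\sum_(b <- B) c b *: mwordop W b (h a)) (h d) =
  if `[< exists2 b, b \in B & d = mcat b a >] then hdot (g (h a)) (h d) else 0.
Proof.
have term b : hdot (c b *: mwordop W b (h a)) (h d) =
    if mcat b a == d then hdot (g (h a)) (h d) else 0.
  rewrite hdotZl (mwordop_hbasisE m_gt0 q_reg) hdotZl (hbasis_dot m_gt0 q_reg).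
  case: eqP => [<-|_]; last by rewrite !mulr0.
  have [-> _] := g_toeplitz; rewrite -realCM divfK; first by rewrite mulrC.
  by rewrite gt_eqF// msqnorm_gt0.
rewrite hdot_suml; case: asboolP => [[b bB dE]|nB].
  rewrite (big_fsetD1 b)//= term -dE eqxx big1_fset ?addr0// => b'.
  rewrite !inE => /andP[b'b _] _; rewrite term; case: eqP => // b'E.
  by case/eqP: b'b; apply: (@mcat_injl _ _ _ _ a); rewrite b'E.
rewrite big1_seq// => b /andP[_ bB]; rewrite term; case: eqP => // bE.
by case: nB; exists b.
Qed.

(** By the Toeplitz form, the partial sum over [B] keeps the coordinates of
    [g (h a)] at the words [mcat b a] with [b] in [B], and there are no others. *)
Lemma fourier_rep_coef : fourier_rep m q g c.
Proof.
move=> a; have lin_g := bounded_lin g_bounded.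
have cvg_h : (fun B : {fset mword n} => \sum_(b <- B) c b *: mwordop W b (h a))
    @ fset_filter (mword n) --> g (h a).
  apply: (@multiplier_cvg _ _ _ _ (tensor_onb E) _ (fset_filter (mword n)) _
    (fun B : {fset mword n} => \sum_(b <- B) c b *: mwordop W b (h a)) (g (h a))
    (fun (B : {fset mword n}) d => (`[< forall b, d = mcat b a -> b \in B >])%:R : R)).
  - apply: filterE => B d; apply: (hdot_multiplier m_gt0 q_reg).
    rewrite hdot_mword_sum; case: asboolP => [[b bB dE]|nB].
      case: asboolP => [_|[]]; first by rewrite mul1r.
      move=> b' dE'; suff -> : b' = b by [].
      by apply: (@mcat_injl _ _ _ _ a); rewrite -dE -dE'.
    case: asboolP => [dB|_]; last by rewrite mul0r.
    rewrite mul1r; have [_ ->]// := g_toeplitz.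
    by move=> b dE; case: nB; exists b => //; exact: dB.
  - by apply: filterE => B d; rewrite ler0n lern1 leq_b1.
  move=> d r r0; have [[b dE]|nd] := pselect (exists b, d = mcat b a).
    apply: filterS (fset_filter_ge [fset b]%fset) => B bB.
    case: asboolP => [_|[]]; first by rewrite lerBlDr lerDl ltW.
    move=> b' dE'; have -> : b' = b.
      by apply: (@mcat_injl _ _ _ _ a); rewrite -dE -dE'.
    by rewrite -fsub1set.
  apply: filterE => B; case: asboolP => [_|[]]; first by rewrite lerBlDr lerDl ltW.
  by move=> b dE; case: nd; exists b.
have sN0 : (Num.sqrt (N a))%:C != 0 :> R[i].
  by rewrite fmorph_eq0 gt_eqF// sqrtr_gt0 msqnorm_gt0.
have eE : tensor_basis E a = ((Num.sqrt (N a))%:C)^-1 *: h a.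
  by rewrite /hbasis scalerA mulVf// scale1r.
rewrite eE (linZ lin_g).
suff : (fun B : {fset mword n} => \sum_(b <- B) c b *:
    mwordop W b ((Num.sqrt (N a))%:C^-1 *: h a)) @ fset_filter (mword n) -->
    (Num.sqrt (N a))%:C^-1 *: g (h a) by [].
apply: cvg_trans (cvgZl_tmp (k := (Num.sqrt (N a))%:C^-1) cvg_h).
apply: near_eq_cvg; apply: filterE => B /=; rewrite scaler_sumr.
apply: eq_bigr => b _; have lW := bounded_lin (mwordop_bounded m_gt0 q_reg E b).
by rewrite (linZ lW _ (h a)) !scalerA mulrC.
Qed.

Definition homogeneous (H : hilbertType R) (X : optuple n H) (s : nat) (x : H) : H :=
  \sum_(b <- fset_set [set b : mword n | mlength b = s]) c b *: mwordop X b x.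

Lemma homogeneous_bounded s : bounded_op (homogeneous W s).
Proof.
have -> : homogeneous W s =
    \sum_(b <- fset_set [set b : mword n | mlength b = s]) c b *: mwordop W b.
  by apply/funext => x; rewrite /homogeneous fct_sumE.
by apply: bounded_sum => b; exact: mwordop_bounded.
Qed.

Lemma homogeneous_hbasis s a d : hdot (homogeneous W s (h a)) (h d) =
  if mlength d == (mlength a + s)%N then hdot (g (h a)) (h d) else 0.
Proof.
rewrite hdot_mword_sum; case: asboolP => [[b]|nb].
  rewrite in_fset_set; last exact: finite_mlength.
  by rewrite inE /= => <- ->; rewrite mlength_cat addnC eqxx.
case: eqP => // ds; have [_ ->]// := g_toeplitz.
move=> b dE; apply: nb; exists b => //.
rewrite in_fset_set; last exact: finite_mlength.
by rewrite inE /=; move: ds; rewrite dE mlength_cat addnC => /addnI.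
Qed.

Context (C : R).
Hypotheses (C_ge0 : 0 <= C) (g_le : forall x, nrm (g x) <= C * nrm x).

Let entries_onb (G : E -> E) (kap : R) a d : linear G ->
  hdot (G (h a)) (h d) = kap%:C * hdot (g (h a)) (h d) ->
  hdot (G (tensor_basis E a)) (tensor_basis E d) =
    kap%:C * hdot (g (tensor_basis E a)) (tensor_basis E d).
Proof.
move=> linG; have lin_g := bounded_lin g_bounded.
have sN0 : (Num.sqrt (N a))%:C != 0 :> R[i].
  by rewrite fmorph_eq0 gt_eqF// sqrtr_gt0 msqnorm_gt0.
move=> /(hdot_multiplier m_gt0 q_reg).
by rewrite /hbasis (linZ linG) (linZ lin_g) !hdotZl mulrCA => /(mulfI sN0).
Qed.

(** The homogeneous part of degree [s] selects the entries with
    [mlength d = mlength a + s], a Schur multiplier with zero-one rows. *)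
Lemma homogeneous_le s x : nrm (homogeneous W s x) <= C * nrm x.
Proof.
have bG := homogeneous_bounded s; have lin_g := bounded_lin g_bounded.
apply: (schur_bound (tensor_onb E) bG C_ge0) => A.
pose L := (\sum_(d <- A) mlength d).+1.
have dL d : d \in A -> (mlength d < L)%N.
  by move=> dA; rewrite ltnS (big_fsetD1 d)//= leq_addr.
have pick1 (p : nat) : \sum_(l < L) ((l == p :> nat)%:R : R) ^+ 2 <= 1.
  have [pL|Lp] := ltnP p L.
    rewrite (eq_bigr (fun l : 'I_L => 1 * (if l == p :> nat then 1 else 0))).
      by rewrite (sum_pick (fun=> 1))// mulr1.
    by move=> l _; case: eqP => _; rewrite ?expr1n ?expr0n !mul1r.
  rewrite big1 ?ler01// => l _; case: eqP => [lp|_]; last by rewrite expr0n.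
  by have := ltn_ord l; rewrite lp ltnNge Lp.
apply: (@schur_finite _ _ _ _ (tensor_onb E) _ _ _ lin_g bG C_ge0 g_le _ L
  (fun a l => (l == (mlength a + s)%N)%:R) (fun d l => (l == mlength d)%:R)) => //.
move=> a d aA dA; apply: entries_onb; first exact: bounded_lin.
rewrite homogeneous_hbasis.
rewrite (eq_bigr (fun l : 'I_L => (l == (mlength a + s)%N :> nat)%:R *
   (if l == mlength d :> nat then 1 else 0))); last by move=> l _; case: (_ == mlength d).
rewrite (sum_pick (fun l => (l == (mlength a + s)%N)%:R)) ?dL// mulr1.
by case: eqP => _; rewrite ?mul1r ?mul0r.
Qed.

Section AbelMean.
Context (r : R) (G : E -> E).
Hypotheses (r01 : 0 <= r < 1) (G_bounded : bounded_op G).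
Hypothesis G_sum : forall N x,
  nrm (\sum_(0 <= s < N) (r ^+ s)%:C *: homogeneous W s x - G x) <=
  r ^+ N * (C / (1 - r)) * nrm x.

Lemma abel_sum_cvg x :
  \sum_(0 <= s < l) (r ^+ s)%:C *: homogeneous W s x @[l --> \oo] --> G x.
Proof.
apply/nrm_cvgP => e e0; have [r0 r1] := andP r01.
have rN : r ^+ l * (C / (1 - r) * nrm x) @[l --> \oo] --> (0 : R).
  rewrite -[X in _ --> X](mul0r (C / (1 - r) * nrm x)).
  by apply: cvgM; [apply: cvg_expr; rewrite ger0_norm|exact: cvg_cst].
move/cvgrPdist_lt : rN => /(_ _ e0); apply: filterS => l.
rewrite sub0r normrN nrmB mulrA => rl.
by apply: le_lt_trans (G_sum _ _) _; apply: le_lt_trans rl; exact: ler_norm.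
Qed.

(** The entries of [g] with [mlength d < mlength a] vanish, so the exponent may be
    made symmetric in [a] and [d]; one of the two truncated differences is zero. *)
Lemma abel_hbasis a d : hdot (G (h a)) (h d) =
  (r ^+ ((mlength a - mlength d) + (mlength d - mlength a)))%:C *
    hdot (g (h a)) (h d).
Proof.
pose z := (r ^+ (mlength a - mlength d + (mlength d - mlength a)))%:C *: g (h a).
rewrite -[RHS]hdotZl -/z.
have cvgz : (fun _ : nat => z) @ \oo --> z by exact: cvg_cst.
apply: (hdot_lim _ (@abel_sum_cvg (h a)) cvgz); rewrite /z {z cvgz}.
exists (mlength d).+1 => // l /= dl; rewrite hdotZl hdot_suml big_mkord.
under eq_bigr do rewrite hdotZl homogeneous_hbasis.
have [ad|da] := leqP (mlength a) (mlength d).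
  have lt_l : (mlength d - mlength a < l)%N by rewrite (leq_ltn_trans (leq_subr _ _)).
  rewrite (bigD1 (Ordinal lt_l))//= subnKC// eqxx big1 ?addr0.
    by rewrite (eqP ad) add0n.
  move=> s sd; case: eqP => [dE|_]; last by rewrite mulr0.
  by case/eqP: sd; apply: val_inj; rewrite /= dE addKn.
have [_ ->] := g_toeplitz; last first.
  by move=> b dE; move: da; rewrite dE mlength_cat ltnNge leq_addl.
by rewrite mulr0 big1// => s _; rewrite if_same mulr0.
Qed.

Lemma abel_le x : nrm (G x) <= C * nrm x.
Proof.
have lin_g := bounded_lin g_bounded.
apply: (schur_bound (tensor_onb E) G_bounded C_ge0) => A.
pose L := (\sum_(d <- A) mlength d).+1.
have dL d : d \in A -> (mlength d < L)%N.
  by move=> dA; rewrite ltnS (big_fsetD1 d)//= leq_addr.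
apply: (@schur_finite _ _ _ _ (tensor_onb E) _ _ _ lin_g G_bounded C_ge0 g_le _ L
  (fun a => abel_row r (mlength a)) (fun d => abel_row r (mlength d))).
- move=> a d /dL aL /dL dL'; apply: entries_onb; first exact: bounded_lin.
  rewrite abel_hbasis; congr (_%:C * _).
  wlog ad : a d aL dL' / (mlength a <= mlength d)%N => [hw|].
    have [/hw->//|/ltnW/hw {}hw] := leqP (mlength a) (mlength d).
    by rewrite addnC hw//; apply: eq_bigr => l _; rewrite mulrC.
  have := @abel_row_dot _ _ r01 L (mlength a) (mlength d - mlength a).
  by rewrite subnKC// => ->//; rewrite (eqP ad) add0n.
- by move=> a /dL aL; rewrite abel_row_norm.
- by move=> a /dL aL; rewrite abel_row_norm.
Qed.

End AbelMean.

(** The Abel means tend strongly to [g] because they are bounded by [C], uniformly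
    in [r], and converge on the basis. *)
Theorem abel_means : exists G : R -> E -> E,
  [/\ forall r, 0 <= r < 1 -> bounded_op (G r),
      forall r, 0 <= r < 1 -> forall N x,
        nrm (\sum_(0 <= s < N) (r ^+ s)%:C *: homogeneous W s x - G r x) <=
        r ^+ N * (C / (1 - r)) * nrm x &
      forall x, G r x @[r --> (1 : R)^'-] --> g x].
Proof.
have ex r : exists G : E -> E, 0 <= r < 1 -> bounded_op G /\ forall N x,
    nrm (\sum_(0 <= s < N) (r ^+ s)%:C *: homogeneous W s x - G x) <=
    r ^+ N * (C / (1 - r)) * nrm x.
  have [r01|nr] := pselect (0 <= r < 1); last by exists idfun.
  have [G bG GP] := power_series_op (fun s => bounded_lin (homogeneous_bounded s))
    homogeneous_le C_ge0 r01.
  by exists G.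
have [G GP] := choice ex; exists G.
have bG r : 0 <= r < 1 -> bounded_op (G r) by case/GP.
have sG r : 0 <= r < 1 -> forall N x,
    nrm (\sum_(0 <= s < N) (r ^+ s)%:C *: homogeneous W s x - G r x) <=
    r ^+ N * (C / (1 - r)) * nrm x by case/GP.
have lin_g := bounded_lin g_bounded.
have near01 : \forall r \near (1 : R)^'-, 0 <= r < 1.
  near=> r; apply/andP; split; near: r.
    by apply: nbhs_left_ge; exact: ltr01.
  exact: nbhs_left_lt.
have G_basis a : G r (tensor_basis E a) @[r --> (1 : R)^'-] --> g (tensor_basis E a).
  apply: (@multiplier_cvg _ _ _ _ (tensor_onb E) _ _ _ _ _ (fun r d =>
    r ^+ ((mlength a - mlength d) + (mlength d - mlength a)))).
  - apply: filterS near01 => r r01 d; apply: entries_onb.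
      exact: bounded_lin (bG r r01).
    exact: (abel_hbasis r01 (sG r r01)).
  - apply: filterS near01 => r /andP[r0 r1] d.
    by rewrite exprn_ge0//= exprn_ile1// ltW.
  move=> d e e0; set p := (_ + _)%N.
  have : r ^+ p @[r --> (1 : R)^'-] --> (1 : R).
    rewrite -[X in _ --> X](expr1n _ p).
    by apply: cvg_at_left_filter; exact: exprn_continuous.
  move/cvgrPdist_lt => /(_ e e0); apply: filterS => r.
  by rewrite ltr_norml => /andP[_]; lra.
split => // x; apply/nrm_cvgP => e e0.
pose d := e / (2 * C + 1) / 2.
have den : 0 < 2 * C + 1 by rewrite ltr_wpDl// mulr_ge0.
have d0 : 0 < d by rewrite !divr_gt0.
have [B xB] := onb_approx (tensor_onb E) x d0.
set y := fcomb _ _ B in xB.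
have Gy : G r y @[r --> (1 : R)^'-] --> g y.
  have Dy (D : E -> E) : linear D -> D y =
      \sum_(t <- B) coords (tensor_basis E) x t *: D (tensor_basis E t).
    by move=> lD; rewrite /y (lin_sum lD); apply: eq_bigr => t _; rewrite (linZ lD).
  rewrite (Dy g)//.
  have sumB := @sum_cvg _ E _ (1 : R)^'- _ _ B
    (fun t r => coords (tensor_basis E) x t *: G r (tensor_basis E t))
    (fun t => coords (tensor_basis E) x t *: g (tensor_basis E t))
    (fun t => cvgZl_tmp (k := coords (tensor_basis E) x t) (G_basis t)).
  apply: cvg_trans (sumB _ _); apply: near_eq_cvg.
  apply: filterS near01 => r r01; have linG := bounded_lin (bG r r01).
  by rewrite (Dy (G r)).
move/nrm_cvgP : Gy => /(_ (e / 2)); rewrite divr_gt0// => /(_ isT) Gy.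
apply: filterS (filterI near01 Gy) => r [r01 Gry].
have linG := bounded_lin (bG r r01).
have -> : g x - G r x = g (x - y) + (g y - G r y) - G r (x - y).
  by rewrite (linB lin_g) (linB linG) addrA subrK opprB addrA subrK.
have h1 : nrm (g (x - y)) <= C * d.
  by apply: le_trans (g_le _) _; rewrite ler_wpM2l// ltW.
have h2 : nrm (G r (x - y)) <= C * d.
  by apply: le_trans (abel_le r01 (bG r r01) (sG r r01) _) _; rewrite ler_wpM2l// ltW.
have dE : d * (2 * C + 1) = e / 2 by rewrite /d; field; rewrite gt_eqF.
have t1 := nrmD (g (x - y) + (g y - G r y)) (- G r (x - y)).
have t2 := nrmD (g (x - y)) (g y - G r y).
rewrite nrmN in t1.
lra.
Unshelve. all: by end_near.
Qed.

End Toeplitz.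

(** * Tuples with a co-isometric extension to the shifts *)

Section Subspaces.
Context (R : realType) (H : hilbertType R) (M : closed_subspace H).

Lemma compress_bounded A : bounded_op A -> bounded_op (compress M A).
Proof.
move=> /bounded_opP[linA [c c0 cA]]; apply/bounded_opP; split=> [a x y|].
  apply: hdot_inj => z; rewrite hdotDl hdotZl !compressP.
  by rewrite csub_val_linear linA hdotDl hdotZl.
exists c => // x; apply: nrm_hdot => [|y]; first by rewrite mulr_ge0// nrm_ge0.
rewrite compressP; apply: le_trans (cabs_hdot _ _) _.
by apply: ler_wpM2r; [exact: nrm_ge0|exact: (cA (csub_val x))].
Qed.

Lemma adj_compress A : bounded_op A ->
  (forall x, csub_set M x -> csub_set M (adj A x)) ->
  forall x : M, adj A (csub_val x) = csub_val (adj (compress M A) x).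
Proof.
move=> bA AM x.
have [B BP] := choice (fun x : M => csub_val_ex (AM _ (csub_valP x))).
rewrite (_ : adj (compress M A) = B) ?BP//; apply: adj_eq => u v.
by rewrite compressP adjP// -BP hdot_csub_val.
Qed.

Lemma compress_coext k (n : 'I_k -> nat) (X : optuple n H) :
  (forall i j, bounded_op (X i j)) -> coinvariant X (csub_set M) ->
  coextension (@csub_val _ _ M) (fun i j => compress M (X i j)) X.
Proof.
move=> bX XM; split=> //.
  by move=> i j; exact: compress_bounded.
by move=> i j x; apply: adj_compress => // y; exact: XM.
Qed.

End Subspaces.

Lemma coext_trans (R : realType) k (n : 'I_k -> nat) (H K L : hilbertType R)
    (V : H -> K) (V' : K -> L) (T : optuple n H) (X : optuple n K) (Y : optuple n L) :
  coextension V T X -> coextension V' X Y -> coextension (V' \o V) T Y.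
Proof.
move=> [lV iV bT bX aV] [lV' iV' _ bY aV']; split=> //.
- by move=> a x y; rewrite /= lV lV'.
- by move=> x y; rewrite /= iV' iV.
- by move=> i j x; rewrite /= aV' aV.
Qed.

Lemma unitary_coext (R : realType) k (n : 'I_k -> nat) (H K : hilbertType R)
    (U : H -> K) (T : optuple n H) (X : optuple n K) :
  unitary_op U -> (forall i j, bounded_op (X i j)) ->
  (forall i j, T i j = adj U \o X i j \o U) -> coextension U T X.
Proof.
move=> [lU iU sU] bX TX.
have bU : bounded_op U.
  apply/bounded_opP; split=> //; exists 1 => // x; rewrite mul1r.
  rewrite -(@ler_pXn2r _ 2) ?nnegrE ?nrm_ge0// -lecR -!hdot_nrm.
  by rewrite iU.
have UU y : U (adj U y) = y.
  apply: hdot_inj => z; have [x _ <-] : range U z by rewrite sU.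
  by rewrite iU -adjPr.
have bT i j : bounded_op (T i j).
  by rewrite TX; apply: bounded_comp => //; apply: bounded_comp => //; exact: adj_bounded.
split=> // i j x; apply: hdot_inj => z.
have [y _ <-] : range U z by rewrite sU.
by rewrite iU -!adjPr// TX /= -adjP.
Qed.

Section OverShifts.
Context (R : realType) (k : nat) (n m : 'I_k -> nat).
Hypothesis m_gt0 : forall i, (0 < m i)%N.
Context (q : forall i, ncpoly R (n i)).
Hypothesis q_reg : forall i, positive_regular (q i).
Context (F : forall i, fock_space R (n i)) (E : hilbert_tensor F).

Notation W := (tensor_shift m q (E := E)).
Notation h := (hbasis m q E).

Lemma tensor_shift_comm s t i j : s != t -> W s i \o W t j = W t j \o W s i.
Proof.
move=> st; apply/funext => x; apply: (hbasis_eq m_gt0 q_reg) => d /=.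
rewrite !(tensor_shift_hbasis m_gt0 q_reg) upd_out// upd_out 1?eq_sym//.
case: ifP => _; case: ifP => // _; congr (hdot x (h _)); apply: mwordP => i'.
have [<-|ti'] := eqVneq t i'; first by rewrite upd_in upd_out ?upd_in.
rewrite [in LHS]upd_out//; have [<-|si'] := eqVneq s i'.
  by rewrite !upd_in.
by rewrite !upd_out.
Qed.

Context (H : hilbertType R) (V : H -> E) (T : optuple n H).
Arguments T : clear implicits.
Hypothesis VTW : coextension V T W.

Let bT := coext_boundedl VTW.
Let bW := coext_boundedr VTW.

Lemma nrm_coext x : nrm (V x) = nrm x.
Proof.
apply/eqP; rewrite -(@eqrXn2 _ 2) ?nrm_ge0//; apply/eqP/(@complexI R).
by rewrite -!hdot_nrm (coext_isometry VTW).
Qed.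

Lemma coext_bounded : bounded_op V.
Proof.
apply/bounded_opP; split; first exact: coext_linear VTW.
by exists 1 => // x; rewrite mul1r nrm_coext.
Qed.

Lemma nrm_adj_coext z : nrm (adj V z) <= nrm z.
Proof.
apply: nrm_hdot => [|y]; first exact: nrm_ge0.
rewrite -adjPr; last exact: coext_bounded.
by rewrite -(nrm_coext y); exact: cabs_hdot.
Qed.

Lemma coext_polydomain : polydomain q m T.
Proof.
split=> //.
  move=> s t st i j; apply/funext => x; apply: hdot_inj => y /=.
  have TT s' t' i' j' : hdot (T s' i' (T t' j' x)) y =
      hdot (W s' i' (W t' j' (V x))) (V y).
    rewrite (adjP (bT i')) (adjP (bT j')) (adjP (bW i')) (adjP (bW j')).
    by rewrite !(coext_adj VTW) (coext_isometry VTW).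
  by rewrite !TT; have /(congr1 (fun A => A (V x))) /= -> := tensor_shift_comm i j st.
move=> p pm x; rewrite (compression_defect VTW q p (compression_id VTW)).
exact: (defect_shift_ge0 m_gt0 q_reg).
Qed.

Lemma coext_pure : pure q T.
Proof.
move=> x y; rewrite -(coext_isometry VTW).
have -> : (fun s => hdot (pure_net q T s x) y) =
    (fun s => hdot (pure_net q W s (V x)) (V y)).
  by apply/funext => s; rewrite (compression_pure_net VTW).
by apply: hdot_cvg; exact: (pure_net_cvg m_gt0 q_reg).
Qed.

Lemma hdot_defect x y : hdot (defect q T m idfun x) y =
  hdot (V x) (vacuum E) * hdot (vacuum E) (V y).
Proof.
rewrite (compression_defect VTW q m (compression_id VTW)).
by rewrite (defect_shift m_gt0 q_reg) hdotZl.
Qed.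

(** Up to nonzero factors, the coordinates of [x] in the basis. *)
Definition vacuum_coord (x : E) (b : mword n) : R[i] :=
  hdot x (mwordop W b (vacuum E)).

Lemma vacuum_coord_eq x y :
  (forall b, vacuum_coord x b = vacuum_coord y b) -> x = y.
Proof.
move=> xy; apply: (hbasis_eq m_gt0 q_reg) => b.
have := xy b; rewrite /vacuum_coord -(hbasis0 m q) (mwordop_hbasisE m_gt0 q_reg).
rewrite mcat0 ![hdot _ (_ *: h b)]hdotZr; apply: mulfI; rewrite conjR fmorph_eq0.
by rewrite mulf_neq0 ?invr_neq0// gt_eqF// msqnorm_gt0.
Qed.

Lemma vacuum_coord_adj x b :
  vacuum_coord (V x) b = hdot (V (adj (mwordop T b) x)) (vacuum E).
Proof.
rewrite -(coext_mwordop VTW) -adjPr//.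
exact: (mwordop_bounded m_gt0 q_reg).
Qed.

(** The defect is [x |-> <x, u> u] with [u = V^* 1]. If [u] were zero, every [V x]
    would be orthogonal to all the vectors [W_b 1]. *)
Lemma coext_rank : (exists x : H, x <> 0) -> has_rank (defect q T m idfun) 1.
Proof.
move=> [x0 x00]; have bV := coext_bounded.
pose u := adj V (vacuum E).
have defE x : defect q T m idfun x = hdot x u *: u.
  apply: hdot_inj => y; rewrite hdot_defect hdotZl adjP//.
  by rewrite /u -adjPr.
have u0 : u != 0.
  apply/eqP => u0; apply: x00; have lV := coext_linear VTW.
  suff : V x0 = V 0.
    rewrite (lin0 lV) => /(congr1 (@nrm _ _)); rewrite nrm_coext nrm0.
    exact: nrm0_eq0.
  apply: vacuum_coord_eq => b; rewrite !vacuum_coord_adj !(adjP bV).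
  by rewrite -/u u0 !hdot0r.
have uu0 : hdot u u != 0.
  by apply: contra u0 => /eqP/hdot_eq0 ->.
exists (fun=> u); split=> [c|].
  rewrite big_ord1 => /eqP; rewrite scaler_eq0 (negbTE u0) orbF => /eqP c0 l.
  by rewrite ord1.
apply/seteqP; split=> _ [x _ <-].
  by exists (fun=> hdot x u) => //; rewrite big_ord1 defE.
exists ((x ord0 / hdot u u) *: u) => //.
by rewrite big_ord1 defE hdotZl divfK.
Qed.

Lemma coext_homogeneous (g : E -> E) s x :
  homogeneous m q g T s x = adj V (homogeneous m q g W s (V x)).
Proof.
apply: hdot_inj => y; rewrite -adjPr; last exact: coext_bounded.
rewrite !hdot_suml; apply: eq_bigr => b _.
by rewrite !hdotZl (compression_mwordop VTW).
Qed.

(** The Abel means of the series at [T] are compressions of those at the shifts,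
    and the latter tend strongly to [g]. *)
Lemma coext_functional_calculus g : hardy_algebra m q (E := E) g ->
  (forall x y, hdot (g (V x)) (V y) = 0) ->
  exists2 c, fourier_rep m q g c & functional_calculus c T (cst 0).
Proof.
move=> hg gV; have [bg _] := hg; have tg := toeplitz_hardy m_gt0 q_reg hg.
have /bounded_opP[_ [C C0 gC]] := bg; have bV := coext_bounded.
have laV := bounded_lin (adj_bounded bV).
exists (fourier_coef m q g); first exact: (fourier_rep_coef m_gt0 q_reg bg tg).
have [G [bG sG cG]] := abel_means m_gt0 q_reg bg tg C0 gC.
exists (fun r x => adj V (G r (V x))).
  move=> r r01 eps eps0; have [r0 r1] := andP r01.
  have : r ^+ N * (C / (1 - r)) @[N --> \oo] --> (0 : R).
    rewrite -[X in _ --> X](mul0r (C / (1 - r))).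
    by apply: cvgM; [apply: cvg_expr; rewrite ger0_norm|exact: cvg_cst].
  move/cvgrPdist_lt => /(_ _ eps0); apply: filterS => N rN x.
  have -> : \sum_(0 <= s < N) \sum_(b \in [set b : mword n | mlength b = s])
      ((r ^+ s)%:C * fourier_coef m q g b) *: mwordop T b x =
      adj V (\sum_(0 <= s < N) (r ^+ s)%:C *: homogeneous m q g W s (V x)).
    rewrite (lin_sum laV); apply: eq_bigr => s _.
    rewrite (linZ laV) -coext_homogeneous fsbig_finite; last exact: finite_mlength.
    by rewrite scaler_sumr; apply: eq_bigr => b _; rewrite scalerA.
  rewrite -(linB laV) !nrmE -realCM lecR; apply: le_trans (nrm_adj_coext _) _.
  apply: le_trans (sG r r01 N (V x)) _; rewrite nrm_coext ler_wpM2r ?nrm_ge0//.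
  by move: rN; rewrite sub0r normrN => /ltW; apply: le_trans; exact: ler_norm.
move=> x; have -> : cst 0 x = adj V (g (V x)).
  by apply: hdot_inj => y; rewrite -adjPr// gV hdot0l.
apply/nrm_cvgP => e e0; move/nrm_cvgP : (cG (V x)) => /(_ e e0).
apply: filterS => r; rewrite -(linB laV); apply: le_lt_trans.
exact: nrm_adj_coext.
Qed.

End OverShifts.

(** * Compressions of the universal model *)

Section IdealCokernel.
Context (R : realType) (k : nat) (n m : 'I_k -> nat).
Hypothesis m_gt0 : forall i, (0 < m i)%N.
Context (q : forall i, ncpoly R (n i)).
Hypothesis q_reg : forall i, positive_regular (q i).
Context (F : forall i, fock_space R (n i)) (E : hilbert_tensor F).
Context (J : set (E -> E)).
Hypothesis J_ideal : wot_closed_left_ideal m q J.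

Notation W := (tensor_shift m q (E := E)).

Lemma ideal_coker_ortho g x y :
  csub_set (ideal_coker J) y -> J g -> hdot y (g x) = 0.
Proof.
move=> yN Jg; apply: yN; apply: subset_closure.
exists 1%N, (fun=> 1), (fun=> g x); split; last by rewrite big_ord1 scale1r.
by move=> _; exists g, x.
Qed.

Lemma ortho_ideal_coker y : (forall g x, J g -> hdot y (g x) = 0) ->
  csub_set (ideal_coker J) y.
Proof.
move=> yJ x xJ; rewrite hdotC.
have sub : lspan [set z | exists g x, J g /\ z = g x] `<=` ortho_set [set y].
  move=> _ [r [c [v [vJ ->]]]] _ ->; rewrite hdot_suml big1// => l _.
  have [g [z [Jg ->]]] := vJ l.
  by rewrite hdotZl hdotC yJ// rmorph0 mulr0.
have := closureS sub xJ; have /closure_id <- := @ortho_closed _ _ [set y].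
by move=> ->//; rewrite rmorph0.
Qed.

(** [W i j \o g] is in the left ideal with [g]. *)
Lemma ideal_coker_coinvariant : coinvariant W (csub_set (ideal_coker J)).
Proof.
have [_ _ _ JW _] := J_ideal.
move=> i j y yN; apply: ortho_ideal_coker => g x Jg.
have bW := tensor_shift_bounded m_gt0 q_reg E j.
rewrite -adjPr//; apply: (ideal_coker_ortho x yN (g := W i j \o g)).
apply: JW => //; split=> //; exists (fun=> W i j) => [_|x'].
  by move=> B [_]; apply; exists i, j.
exact: cvg_cst.
Qed.

Lemma universal_model_coext :
  coextension (@csub_val _ _ (ideal_coker J)) (universal_model m q J) W.
Proof.
apply: compress_coext; last exact: ideal_coker_coinvariant.
by move=> i j; exact: tensor_shift_bounded.
Qed.

Lemma submodel_coext (M : closed_subspace (ideal_coker J)) :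
  coinvariant (universal_model m q J) (csub_set M) ->
  coextension (@csub_val _ _ (ideal_coker J) \o @csub_val _ _ M)
    (fun i j => compress M (universal_model m q J i j)) W.
Proof.
move=> MS; apply: coext_trans universal_model_coext.
by apply: compress_coext => //; exact: coext_boundedl universal_model_coext.
Qed.

End IdealCokernel.

Lemma closed_subspace_eq (R : realType) (H : hilbertType R) (M M' : closed_subspace H) :
  csub_set M = csub_set M' -> M = M'.
Proof.
case: M M' => A sA cA [A' sA' cA'] /= AA'; rewrite -{}AA' in sA' cA' *.
by rewrite (Prop_irrelevance sA sA') (Prop_irrelevance cA cA').
Qed.

(** * Unitary equivalence of compressions *)

(** A rank-one matrix [f f^*] determines [f] up to a scalar. *)
Lemma proportional (R : realType) (T : Type) (f g : T -> R[i]) :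
  (forall a b, f b * Num.conj (f a) = g b * Num.conj (g a)) ->
  exists c, forall b, f b = c * g b.
Proof.
move=> fg; have [f0|/existsNP[a /eqP fa]] := pselect (forall a, f a = 0).
  by exists 0 => b; rewrite mul0r f0.
exists (Num.conj (g a) / Num.conj (f a)) => b.
have cfa : Num.conj (f a) != 0 by rewrite conjC_eq0.
by apply: (mulIf cfa); rewrite fg mulrAC divfK// mulrC.
Qed.

(** Unitary equivalence preserves the rank-one defect, whose matrix entries
    between the vectors [T_b^* x] are the products of the coordinates of [V x] and
    their conjugates. *)
Lemma coext_equivalence (R : realType) (k : nat) (n m : 'I_k -> nat)
    (m_gt0 : forall i, (0 < m i)%N) (q : forall i, ncpoly R (n i))
    (q_reg : forall i, positive_regular (q i)) (F : forall i, fock_space R (n i))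
    (E : hilbert_tensor F) (H H' : hilbertType R) (V : H -> E) (V' : H' -> E)
    (U : H -> H') (T : optuple n H) (T' : optuple n H') :
  coextension V T (tensor_shift m q) -> coextension V' T' (tensor_shift m q) ->
  coextension U T T' -> forall x,
  (exists c, V x = c *: V' (U x)) /\ (exists c, V' (U x) = c *: V x).
Proof.
move=> VTW VTW' UTT' x; pose f y := @vacuum_coord _ _ _ m q _ E y.
have rel a b : f (V x) b * Num.conj (f (V x) a) =
    f (V' (U x)) b * Num.conj (f (V' (U x)) a).
  rewrite /f !(vacuum_coord_adj m_gt0 q_reg VTW) !(vacuum_coord_adj m_gt0 q_reg VTW').
  rewrite -![Num.conj _]hdotC -(hdot_defect m_gt0 q_reg VTW).
  rewrite -(hdot_defect m_gt0 q_reg VTW') !(coext_mwordop UTT').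
  exact: (compression_defect UTT' q m (compression_id UTT')).
have scal y z : (exists c, forall b, f y b = c * f z b) -> exists c, y = c *: z.
  move=> [c yz]; exists c; apply: (vacuum_coord_eq m_gt0 q_reg) => b.
  by rewrite /vacuum_coord hdotZl; exact: yz.
by split; apply/scal/proportional => a b; rewrite rel.
Qed.

Theorem corollary2p9 (R : realType) (k : nat) (k_gt0 : (0 < k)%N)
    (n m : 'I_k -> nat)
    (n_gt0 : forall i, (0 < n i)%N) (m_gt0 : forall i, (0 < m i)%N)
    (q : forall i, ncpoly R (n i)) (q_reg : forall i, positive_regular (q i))
    (F : forall i, fock_space R (n i)) (E : hilbert_tensor F)
    (J : set (E -> E)) (J_ideal : wot_closed_left_ideal m q J)
    (J_vacuum : csub_set (ideal_coker J) (vacuum E)) :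
  let S := universal_model m q J in
  opnorm_closure (lspan
      [set A | exists a b : mword n, A = mwordop S a \o adj (mwordop S b)]) =
    cstar_generated [set A | exists i j, A = S i j] ->
  (forall M : closed_subspace (ideal_coker J),
      coinvariant S (csub_set M) -> csub_set M <> [set 0] ->
      let T : optuple n M := fun i j => compress M (S i j) in
      pure_variety m q J T /\ has_rank (defect q T m idfun) 1) /\
  (forall M M' : closed_subspace (ideal_coker J),
      coinvariant S (csub_set M) -> coinvariant S (csub_set M') ->
      let T : optuple n M := fun i j => compress M (S i j) in
      let T' : optuple n M' := fun i j => compress M' (S i j) in
      unitarily_equivalent T T' <-> csub_set M = csub_set M').
Proof.
move=> S _; have J_hardy : J `<=` hardy_algebra m q (E := E) by case: J_ideal.
split=> [M MS M0 T|M M' MS M'S T T'].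
  have VTW : coextension _ T _ := submodel_coext m_gt0 q_reg J_ideal MS.
  split; last first.
    apply: (coext_rank m_gt0 q_reg VTW); apply: contrapT => /forallNP Mz.
    apply: M0; apply/seteqP; split=> [y /csub_val_ex[x <-]|_ ->]; last exact: csub0.
    by have /contrapT -> := Mz x.
  split.
  - exact: (coext_polydomain m_gt0 q_reg VTW).
  - exact: (coext_pure m_gt0 q_reg VTW).
  move=> g Jg; apply: (coext_functional_calculus m_gt0 q_reg VTW) => [|x y].
    exact: J_hardy.
  rewrite hdotC (ideal_coker_ortho _ _ Jg) ?rmorph0//.
  exact: csub_valP.
split=> [[U uU TU]|/closed_subspace_eq MM']; last first.
  rewrite /T' /T; case: _ / MM'; exists idfun.
    by split=> //; apply/seteqP; split=> // x _; exists x.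
  by move=> i j; rewrite adj_id.
have VTW : coextension _ T _ := submodel_coext m_gt0 q_reg J_ideal MS.
have VTW' : coextension _ T' _ := submodel_coext m_gt0 q_reg J_ideal M'S.
have UTT' := unitary_coext uU (coext_boundedl VTW') TU.
have equiv := coext_equivalence m_gt0 q_reg VTW VTW' UTT'.
apply/seteqP; split=> [y /csub_val_ex[x <-]|y /csub_val_ex[x' <-]].
  have [[c xE] _] := equiv x.
  suff -> : csub_val x = c *: csub_val (U x) by apply: csubZ; exact: csub_valP.
  exact: val_inj.
have [_ _ surj] := uU; have [x _ <-] : range U x' by rewrite surj.
have [_ [c xE]] := equiv x.
suff -> : csub_val (U x) = c *: csub_val x by apply: csubZ; exact: csub_valP.
exact: val_inj.
Qed.
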